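(* Let $\mathcal C$ be the set of all pointed Schreier graphs $(\Gamma,q)$ obtained from the Schreier graph $\Gamma$ of the action of $F$ on the orbit of $\frac12$ by choosing an arbitrary vertex $q$ as base vertex, let $\overline{\mathcal C}$ be its closure in the space $\mathcal T$ of pointed marked graphs, and let $\mathcal D$ be the perfect kernel of $\overline{\mathcal C}$. Then the action of $F$ on $\mathcal D$ induced by the Schreier dynamical system (shifting of the base vertex along labeled edges) is topologically conjugate to the standard action of $F$ on the Cantor set $X^\omega=\{0,1\}^\omega$; that is, there is a homeomorphism $\psi:\mathcal D\to X^\omega$ with $\psi(\Delta^f)=\psi(\Delta)^f$ for all $\Delta\in\mathcal D$ and $f\in F$.
   Context: Thompson's group $F$ is the group of all strictly increasing piecewise linear homeomorphisms of $[0,1]$ that are differentiable except at finitely many dyadic rationals and whose slopes are integer powers of $2$; products are read left to right, $(fg)(x)=g(f(x))$, and $x^f:=f(x)$. It is generated by $x_0,x_1$, where $x_0(t)=t/2$ on $[0,\frac12]$, $t-\frac14$ on $[\frac12,\frac34]$, $2t-1$ on $[\frac34,1]$; and $x_1(t)=t$ on $[0,\frac12]$, $\frac t2+\frac14$ on $[\frac12,\frac34]$, $t-\frac18$ on $[\frac34,\frac78]$, $2t-1$ on $[\frac78,1]$. The standard action of $F$ on the Cantor set $X^\omega$ of infinite words over $X=\{0,1\}$ is induced by binary expansions and is given by $x_0: 0u\mapsto 00u,\ 10u\mapsto 01u,\ 11u\mapsto 1u$; $x_1: 0u\mapsto 0u,\ 10u\mapsto 100u,\ 110u\mapsto 101u,\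 111u\mapsto 11u$. Schreier graph $\Gamma$ of the action on the orbit of $\frac12$: the vertices are the points of the orbit (i.e. all dyadic rationals in $(0,1)$), with a directed edge labeled $s\in\{x_0,x_1\}$ from $y$ to $z$ iff $y^s=z$. $\mathcal T$ is the space of isomorphism classes of connected pointed marked graphs: directed graphs with edges labeled by $x_0,x_1$ such that every vertex has exactly one outgoing and exactly one incoming edge of each label, with a selected base vertex; isomorphisms preserve orientation, labels and base vertex. The metric is $d((\Gamma_1,u),(\Gamma_2,v))=2^{-n}$, where $n$ is the largest integer such that the balls of radius $n$ around $u$ and $v$ are isomorphic as pointed marked graphs (and $d=0$ if the pointed graphs are isomorphic). Schreier dynamical system: $F$ acts on $\mathcal C$ by shifting the base vertex along labeled edges, $(\Gamma,q)^f=(\Gamma,q^f)$, where $q^{x_i}$ is the end of the edge labeled $x_i$ starting at $q$; this action extends by continuity to $\overline{\mathcal C}$. The perfect kernel of a topological space is the perfect set (a set without isolated points) obtained by iteratively (transfinitely) removing isolated points. *)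

(* Defs.v *)
From HB Require Import structures.
From mathcomp Require Import all_boot all_order all_algebra generic_quotient.
From mathcomp Require Import all_classical all_reals all_analysis.
From mathcomp Require Import ring lra zify.

Set Implicit Arguments.
Unset Strict Implicit.
Unset Printing Implicit Defensive.

Import Order.TTheory GRing.Theory Num.Theory.
Import numFieldNormedType.Exports.

Local Open Scope classical_set_scope.
Local Open Scope ring_scope.

Inductive gen := X0 | X1.

Record marked_graph := MarkedGraph {
  vertex :> Type;
  edge : gen -> vertex -> vertex -> Prop;
  edge_out : forall s y, exists! z, edge s y z;
  edge_in : forall s z, exists! y, edge s y z }.

Definition adj (G : marked_graph) (u v : G) :=
  exists s, edge s u v \/ edge s v u.

(* Distances in a marked graph ignore the orientation of the edges. *)
Fixpoint walk (G : marked_graph) (n : nat) (u v : G) : Prop :=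
  if n is m.+1 then exists2 w, walk m u w & adj w v else u = v.

Definition gball (G : marked_graph) (u : G) (r : nat) : set G :=
  [set v | exists2 k, (k <= r)%N & walk k u v].

Record pmgraph := PMGraph {
  graph : marked_graph;
  base : graph;
  pm_connected : forall v, exists k, walk k base v }.

HB.instance Definition _ := gen_eqMixin pmgraph.
HB.instance Definition _ := gen_choiceMixin pmgraph.

Definition pm_isom (G H : pmgraph) : Prop :=
  exists phi : graph G -> graph H, [/\ bijective phi, phi (base G) = base H &
    forall s y z, edge s y z <-> edge s (phi y) (phi z)].

(* The ball of radius r is the subgraph induced on the vertices at distance
   at most r from the base vertex. *)
Definition ball_isom (r : nat) (G H : pmgraph) : Prop :=
  exists phi : graph G -> graph H,
    [/\ set_bij (gball (base G) r) (gball (base H) r) phi,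
        phi (base G) = base H &
        forall s y z, gball (base G) r y -> gball (base G) r z ->
          (edge s y z <-> edge s (phi y) (phi z))].

(* The largest n such that the balls of radius n are isomorphic; balls of
   radius -1 are empty, so it is -1 when already the balls of radius 0 differ
   (which happens when the base vertices do not carry the same loops). *)
Definition isom_radius (G H : pmgraph) : int :=
  xget (-1) [set n%:Z | n in
    [set n | ball_isom n G H /\ forall m, ball_isom m G H -> (m <= n)%N]].

Definition pm_dist (R : realType) (G H : pmgraph) : R :=
  if `[< pm_isom G H >] then 0 else 2 ^ (- isom_radius G H).

Lemma pm_isom_refl G : pm_isom G G.
Proof. by exists id; split=> //; exists id. Qed.

Lemma pm_isom_sym G H : pm_isom G H -> pm_isom H G.
Proof.
case=> f [[g fK gK] fb fe]; exists g; split; first by exists f.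
  by rewrite -fb fK.
by move=> s y z; rewrite fe !gK.
Qed.

Lemma pm_isom_trans H G K : pm_isom G H -> pm_isom H K -> pm_isom G K.
Proof.
case=> f [bf fb fe] [g [bg gb ge]]; exists (g \o f); split => /=.
- exact: bij_comp.
- by rewrite fb.
- by move=> s y z; rewrite fe ge.
Qed.

Definition pm_isomb : rel pmgraph := fun G H => `[< pm_isom G H >].

Lemma pm_isomb_refl : reflexive pm_isomb.
Proof. by move=> G; apply/asboolP/pm_isom_refl. Qed.

Lemma pm_isomb_sym : symmetric pm_isomb.
Proof. by move=> G H; apply/asboolP/asboolP; apply: pm_isom_sym. Qed.

Lemma pm_isomb_trans : transitive pm_isomb.
Proof.
by move=> H G K /asboolP GH /asboolP HK; apply/asboolP/(pm_isom_trans GH HK).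
Qed.

Canonical pm_isom_equiv :=
  EquivRel pm_isomb pm_isomb_refl pm_isomb_sym pm_isomb_trans.

(* R only serves as the type of values of the metric. *)
Definition mgspace (R : realType) : Type := {eq_quot pm_isom_equiv}%qT.

HB.instance Definition _ (R : realType) := Choice.on (mgspace R).

Definition mgclass (R : realType) (G : pmgraph) : mgspace R :=
  (\pi_({eq_quot pm_isom_equiv}) G)%qT.

Definition mgrepr (R : realType) (x : mgspace R) : pmgraph :=
  @repr _ {eq_quot pm_isom_equiv}%qT x.

Lemma mgreprK R (x : mgspace R) : mgclass R (mgrepr x) = x.
Proof. exact: reprK. Qed.

Lemma mgclassP R (G H : pmgraph) : mgclass R G = mgclass R H <-> pm_isom G H.
Proof.
split=> [/eqmodP/asboolP//|GH]; apply/eqmodP; exact/asboolP.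
Qed.

Lemma gball_base (G : marked_graph) (u : G) r : gball u r u.
Proof. by exists 0%N. Qed.

Lemma gball_le (G : marked_graph) (u : G) r r' :
  (r <= r')%N -> gball u r `<=` gball u r'.
Proof. by move=> rr v [k kr uv]; exists k => //; exact: leq_trans rr. Qed.

Lemma edge_fun (G : marked_graph) s (y z z' : G) :
  edge s y z -> edge s y z' -> z = z'.
Proof. by move=> yz yz'; have [w [_ wP]] := edge_out s y; rewrite -(wP z) // -(wP z'). Qed.

Lemma edge_inj (G : marked_graph) s (y y' z : G) :
  edge s y z -> edge s y' z -> y = y'.
Proof. by move=> yz yz'; have [w [_ wP]] := edge_in s z; rewrite -(wP y) // -(wP y'). Qed.

Lemma pm_isom_ball r G H : pm_isom G H -> ball_isom r G H.
Proof.
case=> f [bf fb fe].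
have fw k v : walk k (base G) v <-> walk k (base H) (f v).
  elim: k v => [|k IH] v /=.
    by rewrite -fb; split=> [->//|]; exact: bij_inj.
  case: (bf) => g fK gK; split.
    case=> w /IH ww [s sP]; exists (f w) => //; exists s.
    by case: sP => /fe; [left|right].
  case=> w; rewrite -(gK w) => /IH ww [s sP]; exists (g w) => //; exists s.
  by case: sP => /fe; [left|right].
exists f; split=> //; split.
- by move=> v [k kr /fw wv]; exists k.
- by move=> x y _ _; exact: bij_inj.
- case: (bf) => g fK gK w [k kr]; rewrite -(gK w) => /fw wv.
  by exists (g w); rewrite ?gK //; exists k.
Qed.

Lemma ball_isom_inv r G H : ball_isom r G H ->
  exists (f : graph G -> graph H) (g : graph H -> graph G),
   [/\ f (base G) = base H,
       forall x, gball (base G) r x -> gball (base H) r (f x) /\ g (f x) = x,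
       forall w, gball (base H) r w -> gball (base G) r (g w) /\ f (g w) = w &
       forall s y z, gball (base G) r y -> gball (base G) r z ->
          (edge s y z <-> edge s (f y) (f z))].
Proof.
case=> f [[fsub finj fsurj] fb fe].
have [g gP] : {g : graph H -> graph G | forall w, gball (base H) r w ->
    gball (base G) r (g w) /\ f (g w) = w}.
  have h w : {x | gball (base H) r w -> gball (base G) r x /\ f x = w}.
    apply: cid; have [hw|hw] := pselect (gball (base H) r w).
      by have [x xr xw] := fsurj _ hw; exists x.
    by exists (base G).
  by exists (fun w => sval (h w)) => w; exact: (svalP (h w)).
exists f, g; split=> // x xr; split; first exact: fsub.
have [gr fg] := gP _ (fsub x xr).
by apply: finj fg; rewrite inE.
Qed.

Lemma ball_isom_mk r G H (f : graph G -> graph H) (g : graph H -> graph G) :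
  f (base G) = base H ->
  (forall x, gball (base G) r x -> gball (base H) r (f x) /\ g (f x) = x) ->
  (forall w, gball (base H) r w -> gball (base G) r (g w) /\ f (g w) = w) ->
  (forall s y z, gball (base G) r y -> gball (base G) r z ->
     (edge s y z <-> edge s (f y) (f z))) -> ball_isom r G H.
Proof.
move=> fb fP gP fe; exists f; split=> //; split.
- by move=> x /fP[].
- move=> x y; rewrite !inE => xr yr fxy.
  by rewrite -(fP x xr).2 -(fP y yr).2 fxy.
- by move=> w /gP[gw fgw]; exists (g w).
Qed.

Lemma ball_isom_sym r G H : ball_isom r G H -> ball_isom r H G.
Proof.
case/ball_isom_inv => f [g [fb fP gP fe]].
apply: (@ball_isom_mk r H G g f) => //.
  by rewrite -fb (fP _ (gball_base _ _)).2.
move=> s y z /gP[gy fgy] /gP[gz fgz]; by rewrite fe // fgy fgz.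
Qed.

Lemma ball_isom_trans r H G K :
  ball_isom r G H -> ball_isom r H K -> ball_isom r G K.
Proof.
case=> f [bf fb fe] [g [bg gb ge]]; exists (g \o f); split => /=.
- exact: set_bij_comp bf bg.
- by rewrite fb.
- case: bf => fsub _ _ s y z yr zr; rewrite fe // ge //; exact: fsub.
Qed.

Lemma ball_isom_walk r G H (f : graph G -> graph H) : f (base G) = base H ->
  (forall s y z, gball (base G) r y -> gball (base G) r z ->
     (edge s y z -> edge s (f y) (f z))) ->
  forall k v, (k <= r)%N -> walk k (base G) v -> walk k (base H) (f v).
Proof.
move=> fb fe; elim=> [|k IH] v /= kr; first by move=> <-; rewrite fb.
case=> w ww [s sP]; exists (f w); first exact: IH (ltnW kr) ww.
have wr : gball (base G) r w by exists k => //; exact: ltnW.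
have vr : gball (base G) r v.
  by exists k.+1 => //=; exists w => //; exists s.
by exists s; case: sP => e; [left|right]; exact: fe.
Qed.

Lemma ball_isom_le r r' G H : (r <= r')%N -> ball_isom r' G H -> ball_isom r G H.
Proof.
move=> rr /ball_isom_inv[f [g [fb fP gP fe]]].
have gb : g (base H) = base G by rewrite -fb (fP _ (gball_base _ _)).2.
have fw := @ball_isom_walk r' G H f fb
  (fun s y z yr zr => (fe s y z yr zr).1).
have gw := @ball_isom_walk r' H G g gb.
apply: (@ball_isom_mk r G H f g) => //.
- move=> x xr; split; last exact: (fP _ (gball_le rr xr)).2.
  by case: xr => k kr xk; exists k => //; apply: fw => //; exact: leq_trans rr.
- move=> w wr; split; last exact: (gP _ (gball_le rr wr)).2.
  case: wr => k kr wk; exists k => //; apply: gw => //; last exact: leq_trans rr.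
  move=> s y z /gP[gy fgy] /gP[gz fgz]; by rewrite fe // fgy fgz.
- by move=> s y z /(gball_le rr) yr /(gball_le rr) zr; exact: fe.
Qed.

Lemma ball_isom_uniq G H r r' k (f f' : graph G -> graph H) :
  (k <= r)%N -> (k <= r')%N ->
  f (base G) = base H -> f' (base G) = base H ->
  (forall s y z, gball (base G) r y -> gball (base G) r z ->
     (edge s y z -> edge s (f y) (f z))) ->
  (forall s y z, gball (base G) r' y -> gball (base G) r' z ->
     (edge s y z -> edge s (f' y) (f' z))) ->
  forall v, walk k (base G) v -> f v = f' v.
Proof.
move=> + + fb fb' fe fe'; elim: k => [|k IH] kr kr' v /=.
  by move=> <-; rewrite fb fb'.
case=> w ww [s sP]; have fw := IH (ltnW kr) (ltnW kr') _ ww.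
have wb q : (k < q)%N -> gball (base G) q w by move=> /ltnW ?; exists k.
have vb q : (k < q)%N -> gball (base G) q v.
  by move=> ?; exists k.+1 => //=; exists w => //; exists s.
case: sP => e.
  apply: (@edge_fun (graph H) s (f w)); first by apply: fe => //; [exact: wb|exact: vb].
  by rewrite fw; apply: fe' => //; [exact: wb|exact: vb].
apply: (@edge_inj (graph H) s _ _ (f w)); first by apply: fe => //; [exact: vb|exact: wb].
by rewrite fw; apply: fe' => //; [exact: vb|exact: wb].
Qed.

Lemma ball_isom_all G H : (forall r, ball_isom r G H) -> pm_isom G H.
Proof.
move=> all.
pose f r : graph G -> graph H := sval (cid (all r)).
have fP r := svalP (cid (all r)).
have fb r : f r (base G) = base H by have [] := fP r.
have fe r s y z : gball (base G) r y -> gball (base G) r z ->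
    edge s y z -> edge s (f r y) (f r z).
  by move=> yr zr e; have [_ _ /(_ s y z yr zr) fe] := fP r; exact/fe.
pose K v := sval (cid (@pm_connected G v)).
have KP v : walk (K v) (base G) v := svalP (cid (@pm_connected G v)).
pose phi v := f (K v) v.
have phiE r v : (K v <= r)%N -> phi v = f r v.
  move=> Kr; apply: (@ball_isom_uniq G H (K v) r (K v) (f (K v)) (f r)) => //; first [exact: fb|exact: fe|exact: KP].
have Kb r v : (K v <= r)%N -> gball (base G) r v by move=> Kr; exists (K v).
exists phi; split.
- rewrite -setTT_bijective; split => //.
  + move=> x y _ _; rewrite (phiE (maxn (K x) (K y))) ?leq_maxl//.
    rewrite [phi y](phiE (maxn (K x) (K y))) ?leq_maxr//.
    have [[_ finj _] _ _] := fP (maxn (K x) (K y)).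
    by apply: finj; rewrite inE; apply: Kb; rewrite ?leq_maxl ?leq_maxr.
  + move=> w _; have [k wk] := @pm_connected H w.
    have [[_ _ fsurj] _ _] := fP k.
    have [x [j jk xj] fx] := fsurj w (ex_intro2 _ _ k (leqnn k) wk).
    exists x => //; rewrite -fx (phiE (maxn (K x) k)) ?leq_maxl//.
    apply: (@ball_isom_uniq G H (maxn (K x) k) k j (f (maxn (K x) k)) (f k)) => //; try first [exact: fb|exact: fe|exact: KP].
    by rewrite leq_max jk orbT.
- exact: fb.
- move=> s y z; pose r := maxn (K y) (K z).
  rewrite (phiE r y) ?leq_maxl// (phiE r z) ?leq_maxr//.
  have [_ _] := fP r; apply; apply: Kb; rewrite ?leq_maxl ?leq_maxr//.
Qed.
Lemma isom_radiusP G H : ~ pm_isom G H ->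
  forall k, ball_isom k G H <-> k%:Z <= isom_radius G H.
Proof.
move=> nGH.
have [N HN] : exists N, ~ ball_isom N G H.
  by apply/existsNP => all; apply: nGH; exact: ball_isom_all.
have bd m : ball_isom m G H -> (m < N)%N.
  by move=> bm; rewrite ltnNge; apply/negP => /ball_isom_le /(_ bm).
have [[n0 bn0]|nob] := pselect (exists n, ball_isom n G H); last first.
  move=> k; rewrite /isom_radius xgetPN.
    by split=> [bk|//]; case: nob; exists k.
  by move=> x [n [bn _] _]; apply: nob; exists n.
pose P n := `[< ball_isom n G H >].
have exP : exists n, P n by exists n0; apply/asboolP.
have bP n : P n -> (n <= N)%N by move=> /asboolP/bd/ltnW.
case: (ex_maxnP exP bP) => n /asboolP Pn nmax.
have nmax' m : ball_isom m G H -> (m <= n)%N by move=> bm; apply/nmax/asboolP.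
have -> : isom_radius G H = n.
  rewrite /isom_radius; apply: xget_unique; first by exists n.
  move=> _ [m [bm mmax] <-]; congr Posz; apply/eqP.
  by rewrite eqn_leq nmax' // mmax.
move=> k; rewrite lez_nat; split; first exact: nmax'.
by move=> kn; exact: ball_isom_le Pn.
Qed.

Lemma isom_radius_ge G H : - 1 <= isom_radius G H.
Proof. by rewrite /isom_radius; case: xgetP => // _ -> [n _ <-]. Qed.

Lemma pm_dist_ge0 (R : realType) G H : 0 <= pm_dist R G H.
Proof. by rewrite /pm_dist; case: asboolP => // _; exact: exprz_ge0. Qed.

Lemma pm_dist_lt (R : realType) (k : nat) G H :
  ball_isom k G H <-> pm_dist R G H < 2 ^ (1 - k%:Z).
Proof.
rewrite /pm_dist; case: asboolP => [iso|niso].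
  by split=> _; [exact: exprz_gt0|exact: pm_isom_ball].
rewrite (isom_radiusP niso) ltr_eXz2l ?ltr1n//.
by split; lia.
Qed.

Lemma pm_dist_eq0 (R : realType) G H : pm_dist R G H = 0 -> pm_isom G H.
Proof.
rewrite /pm_dist; case: asboolP => // _ /eqP; rewrite expfz_eq0 pnatr_eq0.
by rewrite andbF.
Qed.

Lemma pm_distE (R : realType) G H :
  pm_dist R G H = 0 \/ exists k : nat, pm_dist R G H = 2 ^ (1 - k%:Z).
Proof.
rewrite /pm_dist; case: asboolP => _; [by left|right].
exists (absz (isom_radius G H + 1)); congr (_ ^ _).
by have := isom_radius_ge G H; lia.
Qed.

Lemma pm_dist_eq (R : realType) G H G' H' :
  (forall k, ball_isom k G H <-> ball_isom k G' H') ->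
  pm_dist R G H = pm_dist R G' H'.
Proof.
have key A B A' B' : (forall k, ball_isom k A B -> ball_isom k A' B') ->
    pm_dist R A' B' <= pm_dist R A B.
  move=> h; have [->|[k Ek]] := pm_distE R A' B'; first exact: pm_dist_ge0.
  rewrite leNgt Ek; apply/negP => /pm_dist_lt/h/(pm_dist_lt R).
  by rewrite Ek ltxx.
by move=> h; apply/eqP; rewrite eq_le !key // => k /h.
Qed.

Lemma pm_distxx (R : realType) G : pm_dist R G G = 0.
Proof. by rewrite /pm_dist asboolT //; exact: pm_isom_refl. Qed.

Lemma pm_dist_sym (R : realType) G H : pm_dist R G H = pm_dist R H G.
Proof. by apply: pm_dist_eq => k; split; exact: ball_isom_sym. Qed.

Lemma pm_dist_triangle (R : realType) H G K :
  pm_dist R G K <= pm_dist R G H + pm_dist R H K.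
Proof.
have [->|[k Ek]] := pm_distE R G K; first by rewrite addr_ge0 ?pm_dist_ge0.
rewrite leNgt; apply/negP => lt.
have GH : ball_isom k G H.
  apply/(pm_dist_lt R); rewrite -Ek; apply: le_lt_trans lt.
  by rewrite lerDl pm_dist_ge0.
have HK : ball_isom k H K.
  apply/(pm_dist_lt R); rewrite -Ek; apply: le_lt_trans lt.
  by rewrite lerDr pm_dist_ge0.
have /(pm_dist_lt R) := ball_isom_trans GH HK.
by rewrite Ek ltxx.
Qed.

Definition mg_dist (R : realType) (x y : mgspace R) : R :=
  pm_dist R (mgrepr x) (mgrepr y).

Lemma mg_dist_eq0 (R : realType) (x y : mgspace R) : mg_dist x y = 0 -> x = y.
Proof. by move=> /pm_dist_eq0/(mgclassP R); rewrite !mgreprK. Qed.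

HB.instance Definition _ (R : realType) := @isMetric.Build R (mgspace R)
  (@mg_dist R) (fun x => pm_distxx R (mgrepr x)) (@mg_dist_eq0 R)
  (fun x y => pm_dist_sym R (mgrepr x) (mgrepr y))
  (fun y x z => pm_dist_triangle R (mgrepr y) (mgrepr x) (mgrepr z)).

(* The distance does not depend on the chosen representatives. *)
Lemma mg_distE (R : realType) G H :
  mg_dist (mgclass R G) (mgclass R H) = pm_dist R G H.
Proof.
have rG A : pm_isom (mgrepr (mgclass R A)) A.
  by apply/(mgclassP R); rewrite mgreprK.
apply: pm_dist_eq => k; split=> h.
  apply: (ball_isom_trans (pm_isom_ball k (pm_isom_sym (rG G)))).
  exact: (ball_isom_trans h (pm_isom_ball k (rG H))).
apply: (ball_isom_trans (pm_isom_ball k (rG G))).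
exact: (ball_isom_trans h (pm_isom_ball k (pm_isom_sym (rG H)))).
Qed.

Definition dyadic (R : realType) (x : R) : Prop :=
  exists (m : int) (n : nat), x = m%:~R / 2 ^+ n.

(* Elements of F are functions on R of which only the restriction to [0, 1]
   matters. A strictly increasing bijection of [0, 1] is a homeomorphism, and
   s is a finite set outside which f is differentiable: f is affine on every
   interval whose interior does not meet s. *)
Record is_thompson (R : realType) (f : R -> R) : Prop := IsThompson {
  thompson_bij : set_bij `[0, 1]%classic `[0, 1]%classic f;
  thompson_incr : {in `[0, 1] &, {homo f : x y / x < y}};
  thompson_pl : exists2 s : seq R, forall x, x \in s -> dyadic x &
    forall a b : R, 0 <= a -> a < b -> b <= 1 ->
      (forall x, x \in s -> ~ (a < x < b)) ->
      exists (k : int) (c : R), forall t : R, a <= t <= b -> f t = 2 ^ k * t + c }.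

Record thompson (R : realType) := Thompson {
  thompson_fun :> R -> R;
  thompsonP : is_thompson thompson_fun }.

Lemma dyadicN (R : realType) (x : R) : dyadic x -> dyadic (- x).
Proof. by case=> m [n ->]; exists (- m), n; rewrite mulrNz mulNr. Qed.

Lemma dyadicD (R : realType) (x y : R) : dyadic x -> dyadic y -> dyadic (x + y).
Proof.
case=> m [n ->] [m' [n' ->]].
exists (m * 2 ^+ n' + m' * 2 ^+ n), (n + n')%N.
rewrite intrD !intrM !rmorphXn /= exprD; field.
by rewrite !expf_neq0.
Qed.

Lemma dyadicM2 (R : realType) (k : int) (x : R) : dyadic x -> dyadic (2 ^ k * x).
Proof.
case=> m [n ->]; case: k => k.
  by exists (2 ^+ k * m), n; rewrite intrM rmorphXn /= mulrA.
exists m, (n + k.+1)%N; rewrite NegzE -exprnN exprD.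
by field; rewrite !expf_neq0.
Qed.

Lemma dyadic0 (R : realType) : dyadic (0 : R).
Proof. by exists 0, 0%N; rewrite mul0r. Qed.

Section thompson_theory.
Variable R : realType.
Implicit Types (f g : R -> R).

Lemma thompson_in f : is_thompson f -> forall x : R, 0 <= x <= 1 -> 0 <= f x <= 1.
Proof. by case=> [[h _ _] _ _] x x01; have := h x; rewrite /= !in_itv /= => /(_ x01). Qed.

Lemma thompson_lt f : is_thompson f ->
  forall x y : R, 0 <= x <= 1 -> 0 <= y <= 1 -> x < y -> f x < f y.
Proof. by case=> _ h _ x y x01 y01; apply: h; rewrite in_itv. Qed.

Lemma thompson_ltE f : is_thompson f ->
  forall x y : R, 0 <= x <= 1 -> 0 <= y <= 1 -> (f x < f y) = (x < y).
Proof.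
move=> tf x y x01 y01; apply/idP/idP; last exact: thompson_lt.
move=> fxy; rewrite ltNge le_eqVlt; apply/negP => /orP[/eqP yx|yx].
  by move: fxy; rewrite yx ltxx.
by have := thompson_lt tf y01 x01 yx; rewrite ltNge (ltW fxy).
Qed.

Lemma thompson_inj f : is_thompson f ->
  forall x y : R, 0 <= x <= 1 -> 0 <= y <= 1 -> f x = f y -> x = y.
Proof.
case=> [[_ h _] _ _] x y x01 y01; apply: h; rewrite inE /= in_itv //=.
Qed.

Lemma thompson_surj f : is_thompson f ->
  forall y : R, 0 <= y <= 1 -> exists2 x, 0 <= x <= 1 & f x = y.
Proof.
case=> [[_ _ h] _ _] y y01; have := h y; rewrite /= in_itv /= => /(_ y01)[x].
by rewrite /= in_itv /=; exists x.
Qed.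

Lemma thompson0 f : is_thompson f -> f 0 = 0.
Proof.
move=> tf; have [x x01 fx] := thompson_surj tf (y := 0) ltac:(by rewrite lexx ler01).
have [x0|x0] := eqVneq x 0; first by rewrite x0 in fx.
have := @thompson_lt f tf 0 x; rewrite lexx ler01 fx => /(_ isT x01).
have /andP[xge _] := x01; rewrite lt_neqAle eq_sym x0 xge => /(_ isT).
have := @thompson_in f tf 0; rewrite lexx ler01 => /(_ isT); lra.
Qed.

Lemma thompson1 f : is_thompson f -> f 1 = 1.
Proof.
move=> tf; have [x x01 fx] := thompson_surj tf (y := 1) ltac:(by rewrite lexx ler01).
have [x0|x0] := eqVneq x 1; first by rewrite x0 in fx.
have := @thompson_lt f tf x 1; rewrite lexx ler01 fx => /(_ x01 isT).
have /andP[_ xle] := x01; rewrite lt_neqAle x0 xle => /(_ isT).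
have := @thompson_in f tf 1; rewrite lexx ler01 => /(_ isT); lra.
Qed.

Lemma last_break (s : seq R) (t : R) : 0 < t ->
  exists a, [/\ 0 <= a, a < t, a = 0 \/ a \in s &
    forall x, x \in s -> ~ (a < x < t)].
Proof.
move=> t0; elim: s => [|y s [a [a0 at_ as_ ah]]].
  by exists 0; split=> //; left.
have [ayt|ayt] := boolP (a < y < t).
  exists y; split.
  - lra.
  - lra.
  - by right; rewrite mem_head.
  - move=> x; rewrite inE => /orP[/eqP->|/ah]; lra.
exists a; split=> //.
  by case: as_ => [|as_]; [left|right]; rewrite // inE as_ orbT.
by move=> x; rewrite inE => /orP[/eqP->|/ah//]; exact/negP.
Qed.

Lemma thompson_dyadic f : is_thompson f ->
  forall t : R, 0 <= t <= 1 -> dyadic t <-> dyadic (f t).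
Proof.
move=> tf t; have [s sd sP] := thompson_pl tf.
have [n] := ubnP (count (fun x : R => x < t) s).
elim: n t => // n IH t cn t01.
have [->|t0] := eqVneq t 0; first by rewrite (thompson0 tf).
have tgt0 : 0 < t by rewrite lt_neqAle eq_sym t0; case/andP: t01.
have [a [a0 at_ as_ ah]] := last_break s tgt0.
have a01 : 0 <= a <= 1 by lra.
have t1 : t <= 1 by lra.
have [k [c kc]] := sP a t a0 at_ t1 ah.
have ft : f t = f a + 2 ^ k * (t - a).
  by rewrite !kc ?lexx ?(ltW at_) //; ring.
have ft' : t = a + 2 ^ (- k) * (f t - f a).
  by rewrite ft -invr_expz; field; rewrite expfz_eq0 pnatr_eq0 andbF.
have [da dfa] : dyadic a /\ dyadic (f a).
  case: as_ => [->|as_]; first by rewrite (thompson0 tf); split; exact: dyadic0.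
  split; first exact: sd.
  apply/(IH a) => //; last exact: sd.
  rewrite ltnS in cn; apply: leq_trans cn; rewrite -addn1.
  have -> : count (fun x : R => x < t) s =
      addn (count (fun x : R => x < a) s) (count (fun x : R => a <= x < t) s).
    rewrite -count_predUI [X in (_ + X)%N](_ : _ = 0%N) ?addn0.
      apply: eq_count => x /=; apply/idP/idP => h; first by case: (ltP x a) => //= ->.
      by case/orP: h => [xa|/andP[]//]; exact: lt_trans at_.
    by apply/eqP; rewrite -leqn0 leqNgt -has_count; apply/hasPn => x _ /=; lra.
  rewrite leq_add2l -has_count.
  by apply/hasP; exists a => //=; rewrite lexx.
split=> [dt|dft].
  rewrite ft; apply: dyadicD dfa _; apply: dyadicM2; apply: dyadicD dt _.
  exact: dyadicN.
rewrite ft'; apply: dyadicD da _; apply: dyadicM2; apply: dyadicD dft _.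
exact: dyadicN.
Qed.

Definition tinv f (y : R) : R := xget 0 [set x | 0 <= x <= 1 /\ f x = y].

Lemma tinvP f : is_thompson f -> forall y : R, 0 <= y <= 1 ->
  0 <= tinv f y <= 1 /\ f (tinv f y) = y.
Proof.
move=> tf y y01; rewrite /tinv; case: xgetP => [_ -> []//|h].
by have [x x01 fx] := thompson_surj tf y01; case: (h x).
Qed.

Lemma tinvK f : is_thompson f -> forall x : R, 0 <= x <= 1 -> tinv f (f x) = x.
Proof.
move=> tf x x01; have [h1 h2] := tinvP tf (thompson_in tf x01).
exact: thompson_inj h2.
Qed.

Lemma is_thompson_mk f g :
  (forall x : R, 0 <= x <= 1 -> 0 <= f x <= 1) ->
  (forall y : R, 0 <= y <= 1 -> 0 <= g y <= 1 /\ f (g y) = y) ->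
  (forall x y : R, 0 <= x <= 1 -> 0 <= y <= 1 -> x < y -> f x < f y) ->
  (exists2 s : seq R, forall x, x \in s -> dyadic x &
    forall a b : R, 0 <= a -> a < b -> b <= 1 ->
      (forall x, x \in s -> ~ (a < x < b)) ->
      exists (k : int) (c : R), forall t : R, a <= t <= b -> f t = 2 ^ k * t + c) ->
  is_thompson f.
Proof.
move=> fin gP fi pl; split=> //; split.
- by move=> x; rewrite /= !in_itv /=; exact: fin.
- move=> x y; rewrite !inE /= !in_itv /= => x01 y01 fxy.
  have [xy|xy|//] := ltgtP x y.
    by have := fi _ _ x01 y01 xy; rewrite fxy ltxx.
  by have := fi _ _ y01 x01 xy; rewrite fxy ltxx.
- move=> y; rewrite /= in_itv /= => /gP[g01 fg]; exists (g y) => //.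
Qed.

Lemma is_thompson_inv f : is_thompson f -> is_thompson (tinv f).
Proof.
move=> tf; have tP := tinvP tf; have tK := tinvK tf; have tin := thompson_in tf.
have lt x y : 0 <= x <= 1 -> 0 <= y <= 1 -> x < y -> tinv f x < tinv f y.
  move=> x01 y01 xy; have [gx fgx] := tP _ x01; have [gy fgy] := tP _ y01.
  by rewrite -(thompson_ltE tf) // fgx fgy.
apply: (@is_thompson_mk _ f) => //.
- by move=> x /tP[].
- by move=> y y01; split; [exact: tin|exact: tK].
have [s sd sP] := thompson_pl tf.
exists [seq f x | x <- s & 0 <= x <= 1].
  move=> y /mapP[x]; rewrite mem_filter => /andP[x01 xs] ->.
  by rewrite -(thompson_dyadic tf) //; exact: sd.
move=> a b a0 ab b1 abs.
have a01 : 0 <= a <= 1 by lra.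
have b01 : 0 <= b <= 1 by lra.
have [ga fga] := tP _ a01; have [gb fgb] := tP _ b01.
have gab := lt _ _ a01 b01 ab.
have [|||x xs xab|k [c kc]] := sP (tinv f a) (tinv f b) => //.
- by case/andP: ga.
- by case/andP: gb.
- have x01 : 0 <= x <= 1 by lra.
  case: (abs (f x)); first by apply: map_f; rewrite mem_filter x01.
  case/andP: xab => /(thompson_lt tf ga x01) + /(thompson_lt tf x01 gb).
  by rewrite fga fgb => -> ->.
exists (- k), (- (2 ^ (- k) * c)) => t /andP[at_ tb].
have t01 : 0 <= t <= 1 by lra.
have le x y : 0 <= x <= 1 -> 0 <= y <= 1 -> x <= y -> tinv f x <= tinv f y.
  by move=> x01 y01; rewrite le_eqVlt => /orP[/eqP->//|/lt h]; exact/ltW/h.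
have [gt fgt] := tP _ t01.
have : f (tinv f t) = 2 ^ k * tinv f t + c by apply: kc; rewrite !le.
rewrite fgt; move: (tinv f t) => u ->; rewrite -invr_expz; field.
by rewrite expfz_eq0 pnatr_eq0 andbF.
Qed.

Lemma is_thompson_comp f g :
  is_thompson f -> is_thompson g -> is_thompson (g \o f).
Proof.
move=> tf tg.
have tfP := tinvP tf; have tgP := tinvP tg.
have fin := thompson_in tf; have gin := thompson_in tg.
apply: (@is_thompson_mk _ (tinv f \o tinv g)) => /=.
- by move=> x /fin/gin.
- move=> y y01; have [g1 g2] := tgP _ y01; have [f1 f2] := tfP _ g1.
  by rewrite f2 g2.
- move=> x y x01 y01 xy; rewrite (thompson_ltE tg) ?fin //.
  by rewrite (thompson_ltE tf).
have [s sd sP] := thompson_pl tf; have [u ud uP] := thompson_pl tg.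
exists (s ++ [seq tinv f y | y <- u & 0 <= y <= 1]).
  move=> x; rewrite mem_cat => /orP[/sd//|/mapP[y]].
  rewrite mem_filter => /andP[y01 yu] ->; have [h1 h2] := tfP _ y01.
  by apply/(thompson_dyadic tf) => //; rewrite h2; exact: ud.
move=> a b a0 ab b1 abs.
have a01 : 0 <= a <= 1 by lra.
have b01 : 0 <= b <= 1 by lra.
have [x xs|k [c kc]] := sP a b a0 ab b1.
  by apply: abs; rewrite mem_cat xs.
have [||||k' [c' kc']] := uP (f a) (f b).
- by have /andP[] := fin _ a01.
- by rewrite (thompson_ltE tf).
- by have /andP[] := fin _ b01.
- move=> y yu yab.
  have y01 : 0 <= y <= 1 by have := fin _ a01; have := fin _ b01; lra.
  have [h1 h2] := tfP _ y01.
  apply: (abs (tinv f y)).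
    by rewrite mem_cat map_f ?orbT // mem_filter y01.
  by rewrite -(thompson_ltE tf a01 h1) -(thompson_ltE tf h1 b01) h2.
exists (k' + k), (2 ^ k' * c + c') => t tab.
have t01 : 0 <= t <= 1 by lra.
rewrite kc'; last first.
  case/andP: tab; rewrite le_eqVlt => at_ tb; apply/andP; split.
    by case/orP: at_ => [/eqP->//|at_]; rewrite ltW // (thompson_ltE tf).
  move: tb; rewrite le_eqVlt => /orP[/eqP->//|tb].
  by rewrite ltW // (thompson_ltE tf).
rewrite kc // expfzDr ?pnatr_eq0 //; ring.
Qed.

End thompson_theory.
Definition thompson_comp (R : realType) (g f : thompson R) : thompson R :=
  Thompson (is_thompson_comp (thompsonP f) (thompsonP g)).

Definition thompson_inv (R : realType) (f : thompson R) : thompson R :=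
  Thompson (is_thompson_inv (thompsonP f)).

Definition x0_fun (R : realType) (t : R) : R :=
  if t <= 1 / 2 then t / 2 else if t <= 3 / 4 then t - 1 / 4 else 2 * t - 1.

Definition x1_fun (R : realType) (t : R) : R :=
  if t <= 1 / 2 then t else if t <= 3 / 4 then t / 2 + 1 / 4
  else if t <= 7 / 8 then t - 1 / 8 else 2 * t - 1.

Lemma dyadic_nat (R : realType) (m n : nat) : dyadic (m%:R / 2 ^+ n : R).
Proof. by exists m%:Z, n. Qed.

Lemma is_thompson_x0 (R : realType) : is_thompson (@x0_fun R).
Proof.
apply: (@is_thompson_mk _ _ (fun y : R => if y <= 1 / 4 then 2 * y else
  if y <= 1 / 2 then y + 1 / 4 else (y + 1) / 2)); rewrite /x0_fun.
- by move=> x x01; do ![case: ifPn]; lra.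
- by move=> y y01; split; do ![case: ifPn]; lra.
- by move=> x y x01 y01 xy; do ![case: ifPn]; lra.
exists [:: 1 / 2; 3 / 4].
  move=> x; rewrite !inE => /orP[]/eqP->.
    by have := @dyadic_nat R 1 1; rewrite expr1.
  by have := @dyadic_nat R 3 2; congr dyadic; field.
move=> a b a0 ab b1 h.
have /negP h1 := h (1 / 2) ltac:(by rewrite !inE eqxx).
have /negP h2 := h (3 / 4) ltac:(by rewrite !inE eqxx orbT).
have [b2|b2] := leP b (1 / 2).
  exists (- 1), 0 => t tab; rewrite exprN1.
  by do ![case: ifPn]; lra.
have [b3|b3] := leP b (3 / 4).
  exists 0, (- (1 / 4)) => t tab; rewrite expr0z.
  by do ![case: ifPn]; lra.
exists 1, (- 1) => t tab; rewrite expr1z.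
by do ![case: ifPn]; lra.
Qed.

Lemma is_thompson_x1 (R : realType) : is_thompson (@x1_fun R).
Proof.
apply: (@is_thompson_mk _ _ (fun y : R => if y <= 1 / 2 then y else
  if y <= 5 / 8 then 2 * y - 1 / 2 else
  if y <= 3 / 4 then y + 1 / 8 else (y + 1) / 2)); rewrite /x1_fun.
- by move=> x x01; do ![case: ifPn]; lra.
- by move=> y y01; split; do ![case: ifPn]; lra.
- by move=> x y x01 y01 xy; do ![case: ifPn]; lra.
exists [:: 1 / 2; 3 / 4; 7 / 8].
  move=> x; rewrite !inE => /or3P[]/eqP->.
  - by have := @dyadic_nat R 1 1; rewrite expr1.
  - by have := @dyadic_nat R 3 2; congr dyadic; field.
  - by have := @dyadic_nat R 7 3; congr dyadic; field.
move=> a b a0 ab b1 h.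
have /negP h1 := h (1 / 2) ltac:(by rewrite !inE eqxx).
have /negP h2 := h (3 / 4) ltac:(by rewrite !inE eqxx orbT).
have /negP h3 := h (7 / 8) ltac:(by rewrite !inE eqxx !orbT).
have [b2|b2] := leP b (1 / 2).
  exists 0, 0 => t tab; rewrite expr0z.
  by do ![case: ifPn]; lra.
have [b3|b3] := leP b (3 / 4).
  exists (- 1), (1 / 4) => t tab; rewrite exprN1.
  by do ![case: ifPn]; lra.
have [b4|b4] := leP b (7 / 8).
  exists 0, (- (1 / 8)) => t tab; rewrite expr0z.
  by do ![case: ifPn]; lra.
exists 1, (- 1) => t tab; rewrite expr1z.
by do ![case: ifPn]; lra.
Qed.

Definition gen_map (R : realType) (s : gen) : thompson R :=
  if s is X0 then Thompson (is_thompson_x0 R) else Thompson (is_thompson_x1 R).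

Definition half_orbit (R : realType) : set R :=
  [set f (1 / 2) | f in [set: thompson R]].
Arguments half_orbit R : clear implicits.

Definition half_vertex (R : realType) : Type := {z : R | half_orbit R z}.

Lemma half_vertex_inj (R : realType) (y z : half_vertex R) :
  sval y = sval z -> y = z.
Proof. by case: y z => [y yP] [z zP] /= yz; exact: eq_exist. Qed.

Lemma half_orbit_act (R : realType) (f : thompson R) (q : half_vertex R) :
  half_orbit R (f (sval q)).
Proof.
have [g _ gq] := svalP q.
by exists (thompson_comp f g) => //=; rewrite gq.
Qed.

Definition orbit_act (R : realType) (f : thompson R) (q : half_vertex R) :
  half_vertex R := exist (half_orbit R) _ (half_orbit_act f q).

Lemma half_orbit01 (R : realType) (q : half_vertex R) : 0 < sval q < 1.
Proof.
have [g _ <-] := svalP q; have gP := thompsonP g.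
rewrite -[X in X < _ < _](thompson0 gP) -[X in _ < _ < X](thompson1 gP).
by rewrite !(thompson_ltE gP); lra.
Qed.

Lemma half_orbit_dyadic (R : realType) (q : half_vertex R) : dyadic (sval q).
Proof.
have [g _ <-] := svalP q; have gP := thompsonP g.
rewrite -(thompson_dyadic gP); last by lra.
by have := @dyadic_nat R 1 1; rewrite expr1.
Qed.

Lemma schreier_out (R : realType) (s : gen) (y : half_vertex R) :
  exists! z : half_vertex R, gen_map R s (sval y) = sval z.
Proof. by exists (orbit_act (gen_map R s) y); split=> // z h; apply/half_vertex_inj. Qed.

Lemma orbit_actVK (R : realType) (f : thompson R) (q : half_vertex R) :
  orbit_act f (orbit_act (thompson_inv f) q) = q.
Proof.
apply/half_vertex_inj => /=; have q01 := half_orbit01 q.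
have [|_ ->//] := tinvP (thompsonP f) (y := sval q); lra.
Qed.

Lemma schreier_in (R : realType) (s : gen) (z : half_vertex R) :
  exists! y : half_vertex R, gen_map R s (sval y) = sval z.
Proof.
exists (orbit_act (thompson_inv (gen_map R s)) z); split.
  by have := congr1 sval (orbit_actVK (gen_map R s) z).
move=> y yz; apply/half_vertex_inj => /=; rewrite -yz.
have y01 := half_orbit01 y.
rewrite tinvK //; [exact: thompsonP|lra].
Qed.

Definition schreier_graph (R : realType) : marked_graph :=
  MarkedGraph (@schreier_out R) (@schreier_in R).
Definition conn (G : marked_graph) (u v : G) := exists k, walk k u v.

Lemma conn_adj (G : marked_graph) (u v w : G) :
  conn u v -> adj v w -> conn u w.
Proof. by case=> k uv vw; exists k.+1 => /=; exists v. Qed.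

Lemma adj_sym (G : marked_graph) (u v : G) : adj u v -> adj v u.
Proof. by case=> s [h|h]; exists s; [right|left]. Qed.

Lemma conn_trans (G : marked_graph) (u v w : G) :
  conn u v -> conn v w -> conn u w.
Proof.
move=> uv [k]; elim: k w => [|k IH] w /=; first by move=> <-.
by case=> w' /IH uw' w'w; exact: conn_adj uw' w'w.
Qed.

Lemma conn_sym (G : marked_graph) (u v : G) : conn u v -> conn v u.
Proof.
case=> k; elim: k v => [|k IH] v /=; first by move=> ->; exists 0%N.
case=> w /IH uw wv; apply: conn_trans uw; exists 1%N => /=.
by exists v => //; exact: adj_sym.
Qed.

Lemma half_orbit_half (R : realType) : half_orbit R (1 / 2).
Proof.
exists (thompson_comp (gen_map R X0) (thompson_inv (gen_map R X0))) => //=.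
by have [] := tinvP (is_thompson_x0 R) (y := 1 / 2) ltac:(lra).
Qed.

Definition half (R : realType) : half_vertex R :=
  exist (half_orbit R) _ (half_orbit_half R).

Section schreier_connected.
Variable R : realType.
Let G := schreier_graph R.

Let conn_img (s : gen) (q q' : G) : gen_map R s (sval q) = sval q' ->
  conn (half R : G) q <-> conn (half R : G) q'.
Proof.
move=> e; split=> h; apply: conn_adj h _; exists s; [left|right]; exact: e.
Qed.

Let scaled (n : nat) (x : R) := exists m : int, x * 2 ^+ n = m%:~R.

Let scaled_half n (x : R) : scaled n.+1 x -> scaled n (2 * x).
Proof. by case=> m h; exists m; rewrite -h exprS; ring. Qed.

Let scaledD n (x y : R) : scaled n x -> scaled n y -> scaled n (x + y).
Proof. by case=> m h [m' h']; exists (m + m'); rewrite mulrDl h h' intrD. Qed.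

Let scaled_dy n k (m : int) : (k <= n)%N -> scaled n (m%:~R / 2 ^+ k).
Proof.
move=> kn; exists (m * 2 ^+ (n - k)); rewrite intrM rmorphXn /=.
rewrite -{1}(subnK kn) exprD mulrACA [_^-1 * _]mulrC mulrA.
by rewrite -!mulrA mulfV ?mulr1 ?expf_neq0.
Qed.

Let schreier_conn n (q : G) : scaled n (sval q) -> conn (half R : G) q.
Proof.
elim: n q => [|n IH] q sq.
  have := half_orbit01 q; case: sq => m; rewrite expr0 mulr1 => ->.
  by rewrite ltr0z -[1]/(1%:~R) ltr_int => h; exfalso; lia.
have inv s : gen_map R s (sval (orbit_act (thompson_inv (gen_map R s)) q)) = sval q.
  by have := congr1 sval (orbit_actVK (gen_map R s) q).
have q01 := half_orbit01 q.
have [q12|q12] := eqVneq (sval q) (1 / 2).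
  by have -> : q = half R by [exact: half_vertex_inj]; exists 0%N.
have n1 : (1 <= n)%N.
  case: n sq {IH} => // -[m]; rewrite expr1 => h; exfalso.
  have : (0 < m < 2)%R.
    have -> : (0 < m) && (m < 2) = (0 < m%:~R :> R) && (m%:~R < 2%:~R :> R).
      by rewrite ltr0z ltr_int.
    by rewrite -h; lra.
  move=> m01; have m1 : m = 1 by lia.
  by move/eqP: q12; apply; move: h; rewrite m1; lra.
have sc1 (m : int) : scaled n (m%:~R / 2).
  by have := @scaled_dy n 1 m n1; rewrite expr1.
have s2q := scaled_half sq.
have big (p : G) : scaled n.+1 (sval p) -> 3 / 4 <= sval p -> conn (half R : G) p.
  move=> sp pge; have p01 := half_orbit01 p.
  apply/(@conn_img X0 p (orbit_act (gen_map R X0) p)) => //.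
  apply: IH => /=; rewrite /x0_fun; do ![case: ifPn]; try lra.
    move=> ? ?; have -> : sval p - 1 / 4 = 1%:~R / 2 by lra.
    exact: sc1.
  move=> _ _; apply: scaledD (scaled_half sp) _.
  by have := sc1 (- 2); congr scaled; rewrite -mulrzr; lra.
have invs s (p : G) : exists v : G, gen_map R s (sval v) = sval p.
  exists (orbit_act (thompson_inv (gen_map R s)) p).
  by have := congr1 sval (orbit_actVK (gen_map R s) p).
have mid (p : G) : scaled n.+1 (sval p) -> 1 / 2 <= sval p -> conn (half R : G) p.
  move=> sp pge; have [|p34] := leP (3 / 4) (sval p); first exact: big.
  have [v vp] := invs X1 p.
  have v01 := half_orbit01 v; have s2p := scaled_half sp.
  apply/(conn_img vp).
  move: vp; rewrite /= /x1_fun => vp.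
  have [p58|p58] := leP (sval p) (5 / 8).
    have [p12|p12] := eqVneq (sval p) (1 / 2).
      have -> : v = half R.
        by apply: half_vertex_inj => /=; move: vp; do ![case: ifPn]; lra.
      by exists 0%N.
    have vE : sval v = 2 * sval p + (-1)%:~R / 2.
      by move: vp p12; rewrite mulrNz neq_lt => + /orP[]; do ![case: ifPn]; lra.
    by apply: IH; rewrite vE; exact: scaledD.
  have vE : sval v = sval p + 1 / 8 by move: vp; do ![case: ifPn]; lra.
  apply/(@conn_img X0 v (orbit_act (gen_map R X0) v)) => //.
  apply: IH => /=; rewrite /x0_fun vE.
  have n2 : (2 <= n)%N.
    rewrite ltn_neqAle n1 andbT; apply/eqP => n1'.
    case: sp => m; rewrite -n1' => h.
    have : (2 < m < 3)%R.
      have -> : (2 < m) && (m < 3) = (2%:~R < m%:~R :> R) && (m%:~R < 3%:~R :> R).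
        by rewrite !ltr_int.
      by rewrite -h !exprS expr0; lra.
    by lia.
  do ![case: ifPn]; try lra; move=> _ _.
  by have := scaledD s2p (scaled_dy (-3) n2); congr scaled; rewrite expr2 mulrNz; lra.
have [|qlt] := leP (1 / 2) (sval q); first exact: mid.
have [v vq] := invs X0 q; have v01 := half_orbit01 v.
apply/(conn_img vq); move: vq; rewrite /= /x0_fun => vq.
have [q14|q14] := leP (sval q) (1 / 4).
  apply: IH; have -> : sval v = 2 * sval q by move: vq; do ![case: ifPn]; lra.
  exact: s2q.
have vE : sval v = sval q + 1%:~R / 2 ^+ 2.
  by rewrite expr2; move: vq; do ![case: ifPn]; lra.
apply: mid; last by rewrite vE expr2; lra.
by rewrite vE; apply: scaledD sq _; exact: scaled_dy.
Qed.

Lemma schreier_connected (u v : G) : exists k, walk k u v.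
Proof.
have h (q : G) : conn (half R : G) q.
  have [m [n qmn]] := half_orbit_dyadic q.
  apply: (@schreier_conn n); exists m.
  by rewrite qmn divfK // expf_neq0.
exact: conn_trans (conn_sym (h u)) (h v).
Qed.

End schreier_connected.

(* The edge labeled s starting at q ends at q^s. *)
Lemma schreier_edge (R : realType) (s : gen) (q z : schreier_graph R) :
  edge s q z <-> z = orbit_act (gen_map R s) q.
Proof. by split=> [h|->//]; apply/half_vertex_inj/esym. Qed.

Definition schreier_pointed (R : realType) (q : half_vertex R) : pmgraph :=
  @PMGraph (schreier_graph R) q (schreier_connected q).

Definition schreier_pt (R : realType) (q : half_vertex R) : mgspace R :=
  mgclass R (schreier_pointed q).

HB.instance Definition _ (R : realType) :=
  isPointed.Build (mgspace R) (schreier_pt (half R)).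

Definition schreier_set (R : realType) : set (mgspace R) :=
  range (@schreier_pt R).
Arguments schreier_set R : clear implicits.

(* The extension by continuity of the shift (Gamma, q) |-> (Gamma, q^f) to the
   closure of the set of the pointed graphs (Gamma, q). *)
Definition schreier_act (R : realType) (f : thompson R) (x : mgspace R) :
    mgspace R :=
  get [set y | forall q : nat -> half_vertex R,
    schreier_pt (q n) @[n --> \oo] --> x ->
    schreier_pt (orbit_act f (q n)) @[n --> \oo] --> y].

(* The transfinite iterates of the operation removing all isolated points; the
   iterate at a limit stage is the intersection of the previous ones. *)
Inductive cb_iterate (T : topologicalType) (A : set T) : set T -> Prop :=
| cb_start : cb_iterate A A
| cb_step B : cb_iterate A B -> cb_iterate A (B `\` isolated B)
| cb_limit (S : set (set T)) : S !=set0 ->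
    (forall B, S B -> cb_iterate A B) -> cb_iterate A (\bigcap_(B in S) B).

Definition perfect_kernel (T : topologicalType) (A : set T) : set T :=
  \bigcap_(B in cb_iterate A) B.

Definition homeomorphism_from (T U : topologicalType) (A : set T)
    (psi : T -> U) : Prop :=
  set_bij A setT psi /\ {within A, continuous psi} /\
  exists2 phi : U -> T, continuous phi & forall x, A x -> phi (psi x) = x.

Definition prepend (p : seq bool) (u : cantor_space) : cantor_space :=
  fun n => if (n < size p)%N then nth false p n else u (n - size p)%N.

(* The number 0.p in binary notation. *)
Fixpoint word_val (R : realType) (p : seq bool) : R :=
  if p is b :: p' then ((b : nat)%:R + word_val R p') / 2 else 0.

(* f maps the interval of the numbers with a binary expansion starting with p
   affinely onto the corresponding interval for q, sending 0.pz to 0.qz. *)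
Definition maps_cylinder (R : realType) (f : R -> R) (p q : seq bool) : Prop :=
  forall t : R, 0 <= t <= 1 ->
    f (word_val R p + t / 2 ^+ size p) = word_val R q + t / 2 ^+ size q.

Definition cantor_act (R : realType) (f : thompson R) (u : cantor_space) :
    cantor_space :=
  get [set v | exists p q z,
    [/\ u = prepend p z, v = prepend q z & maps_cylinder f p q]].

Lemma word_val_cat (R : realType) p r :
  word_val R (p ++ r) = word_val R p + word_val R r / 2 ^+ size p.
Proof.
elim: p => [|b p IH] /=; first by rewrite expr0; lra.
by rewrite IH exprS; field; rewrite expf_neq0.
Qed.

Lemma word_val01 (R : realType) p : 0 <= word_val R p < 1.
Proof. by elim: p => [|[] p IH] /=; lra. Qed.

Lemma word_val_inj (R : realType) p q :
  size p = size q -> word_val R p = word_val R q -> p = q.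
Proof.
elim: p q => [|b p IH] [|c q] //= [/IH {}IH] h.
have := word_val01 R p; have := word_val01 R q.
case: b c h => [] [] h hp hq.
- by rewrite IH //; lra.
- by exfalso; move: h => /=; lra.
- by exfalso; move: h => /=; lra.
- by rewrite IH //; lra.
Qed.

Lemma prepend_cat p r u : prepend (p ++ r) u = prepend p (prepend r u).
Proof.
apply: funext => n; rewrite /prepend size_cat nth_cat.
have [np|pn] := ltnP n (size p); first by rewrite ltn_addr.
by rewrite ltn_subLR // -subnDA.
Qed.

Lemma prepend_split p p' u u' : (size p <= size p')%N ->
  prepend p u = prepend p' u' -> exists2 r, p' = p ++ r & u = prepend r u'.
Proof.
move=> pp e; exists (drop (size p) p').
  rewrite -{1}(cat_take_drop (size p) p'); congr (_ ++ _).
  apply: (@eq_from_nth _ false); rewrite size_takel // => i ip.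
  have := congr1 (fun w : cantor_space => w i) e; rewrite /prepend ip.
  by rewrite (leq_trans ip pp) nth_take // => ->.
apply: funext => n; have := congr1 (fun w : cantor_space => w (size p + n)%N) e.
rewrite /prepend size_drop nth_drop ltnNge leq_addr /= addKn ltn_subRL => ->.
by rewrite subnBA // addnC.
Qed.

Lemma maps_cylinder_cat (R : realType) (f : R -> R) p q r :
  maps_cylinder f p q -> maps_cylinder f (p ++ r) (q ++ r).
Proof.
move=> h t t01; rewrite !word_val_cat !size_cat !exprD.
have -> : word_val R p + word_val R r / 2 ^+ size p + t / (2 ^+ size p * 2 ^+ size r)
  = word_val R p + (word_val R r + t / 2 ^+ size r) / 2 ^+ size p.
  by field; rewrite !expf_neq0.
rewrite h; first by field; rewrite !expf_neq0.
suff : forall s, 0 <= word_val R s + t / 2 ^+ size s <= 1 by apply.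
elim=> [|b s IH] /=; first by rewrite expr0; lra.
have -> : t / 2 ^+ (size s).+1 = (t / 2 ^+ size s) / 2.
  by rewrite exprS; field; rewrite expf_neq0.
by case: b => /=; lra.
Qed.

Lemma maps_cylinder_fun (R : realType) (f : R -> R) p q q' :
  maps_cylinder f p q -> maps_cylinder f p q' -> q = q'.
Proof.
move=> h h'.
have h0 : word_val R q' = word_val R q.
  by have := h' 0; rewrite h ?lexx ?ler01 // !mul0r !addr0 => ->.
have h1 : (2 ^+ size q : R)^-1 = (2 ^+ size q')^-1.
  by have := h' 1; rewrite h ?lexx ?ler01 // h0 !mul1r => /(_ isT)/addrI.
apply: word_val_inj (esym h0); move/invr_inj: h1.
by apply: ieexprIn; lra.
Qed.

Lemma cantor_actE (R : realType) (f : thompson R) p q u :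
  maps_cylinder f p q -> cantor_act f (prepend p u) = prepend q u.
Proof.
move=> fpq; apply: get_unique; first by exists p, q, u.
move=> v [p' [q' [z [e -> fpq']]]].
have [pp|/ltnW pp] := leqP (size p) (size p').
  have [r rp ->] := prepend_split pp e.
  rewrite -prepend_cat; congr prepend; apply/esym.
  by apply: (@maps_cylinder_fun R f p'); rewrite // rp; exact: maps_cylinder_cat.
have [r rp ->] := prepend_split pp (esym e).
rewrite -prepend_cat; congr prepend.
by apply: (@maps_cylinder_fun R f p); rewrite // rp; exact: maps_cylinder_cat.
Qed.

Lemma cantor_act_x0 (R : realType) (u : cantor_space) :
  let x0 := cantor_act (gen_map R X0) in
  [/\ x0 (prepend [:: false] u) = prepend [:: false; false] u,
      x0 (prepend [:: true; false] u) = prepend [:: false; true] u &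
      x0 (prepend [:: true; true] u) = prepend [:: true] u].
Proof.
split; apply: cantor_actE => t t01; rewrite /= /x0_fun ?expr1 ?expr2;
  do ![case: ifPn]; lra.
Qed.

Lemma cantor_act_x1 (R : realType) (u : cantor_space) :
  let x1 := cantor_act (gen_map R X1) in
  [/\ x1 (prepend [:: false] u) = prepend [:: false] u,
      x1 (prepend [:: true; false] u) = prepend [:: true; false; false] u,
      x1 (prepend [:: true; true; false] u) = prepend [:: true; false; true] u &
      x1 (prepend [:: true; true; true] u) = prepend [:: true; true] u].
Proof.
split; apply: cantor_actE => t t01; rewrite /= /x1_fun !exprS expr0;
  do ![case: ifPn]; lra.
Qed.

(* Main.v *)
Require Import Defs.
From mathcomp Require Import all_boot all_order all_algebra.
From mathcomp Require Import all_classical all_reals all_analysis.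
From mathcomp Require Import ring lra zify.

Set Implicit Arguments.
Unset Strict Implicit.
Unset Printing Implicit Defensive.

Import Order.TTheory GRing.Theory Num.Theory.

Local Open Scope classical_set_scope.
Local Open Scope ring_scope.

(** A pointed marked graph is determined by the set of words in the generators
    and their inverses that are closed at its base vertex, and two graphs are
    close in the space of pointed marked graphs when they have the same closed
    words up to some length ([loops_inj], [nbhs_agreeP]). In the Schreier graph
    with base vertex q, a dyadic number, a word is closed when it fixes q. What
    matters is thus which elements of F fix q, and what becomes of this set in
    the limit.

    For a point u of the Cantor set let J_m(u) be the open interval of the
    numbers whose binary expansion starts with the first m digits of u. An element
    of F maps the cylinder of a sufficiently long prefix of u affinely onto
    another cylinder ([thompson_maps_cylinder]). Either this is the identity, or it
    has at most one fixed point; and a given dyadic number is not in J_m(u) for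
    large m. So if dyadic numbers q_n are eventually in every J_m(u), an element
    of F fixes q_n for large n if and only if it is the identity near u
    ([loops_near_germ]). The pointed Schreier graphs therefore converge to the
    graph [germ_pt] u of the germs at u of elements of F, where a germ is a point
    of the Cantor set together with a slope.

    Conversely F has, for every dyadic interval J_p, an element that moves
    exactly the points of J_p ([moves_exactly_inside]): all those
    other than (0, 1) are images of one of three, for which there are explicit words. The closed
    words of a graph thus tell in which of the intervals its base vertex lies. It
    follows that [germ_pt] is injective, that the convergence to [germ_pt] u
    only occurs as described above ([cvg_germ_ptP]), and that a limit of pointed
    Schreier graphs is again one of them or is [germ_pt] u for some u
    ([closure_fixes_level], [closure_germ]): either the base vertices stay among
    the finitely many multiples of some 1 / 2 ^ n in (0, 1), or their intervals
    are nested and describe u.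

    The multiples of 1 / 2 ^ n are the points fixed by all elements for the intervals
    of level n, so every pointed Schreier graph is isolated in the closure. As
    [germ_pt] is continuous and injective, its image has no isolated points. The perfect kernel
    is therefore this image, reached after one step, and the inverse of [germ_pt]
    is a homeomorphism onto the Cantor set. It commutes with the actions because
    f maps J_m(u) onto intervals of the same kind at the image of u, for large m. *)

(** * Closed words of a pointed marked graph *)

Definition word := seq (gen * bool).

Definition letter_edge (G : marked_graph) (a : gen * bool) (u v : G) : Prop :=
  if a.2 then edge a.1 u v else edge a.1 v u.

Fixpoint trace (G : marked_graph) (w : word) (u v : G) : Prop :=
  if w is a :: w' then exists2 c, letter_edge a u c & trace w' c v else u = v.

Definition word_inv (w : word) : word := rev [seq (a.1, ~~ a.2) | a <- w].

Section trace_theory.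
Variable G : marked_graph.
Implicit Types (u v c : G) (w : word).

Lemma letter_edge_total a u : exists v, letter_edge a u v.
Proof.
case: a => s [].
  by have [v [uv _]] := edge_out s u; exists v.
by have [v [uv _]] := edge_in s u; exists v.
Qed.

Lemma letter_edge_fun a u v v' : letter_edge a u v -> letter_edge a u v' -> v = v'.
Proof. by case: a => s [] /=; [exact: edge_fun|exact: edge_inj]. Qed.

Lemma letter_edge_inv s b u v : letter_edge (s, ~~ b) u v <-> letter_edge (s, b) v u.
Proof. by case: b. Qed.

Lemma adj_letter u v : adj u v <-> exists a, letter_edge a u v.
Proof.
split=> [[s [h|h]]|[[s []] h]].
- by exists (s, true).
- by exists (s, false).
- by exists s; left.
- by exists s; right.
Qed.

Lemma trace_total w u : exists v, trace w u v.
Proof.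
elim: w u => [|a w IH] u /=; first by exists u.
have [c uc] := letter_edge_total a u; have [v cv] := IH c.
by exists v, c.
Qed.

Lemma trace_fun w u v v' : trace w u v -> trace w u v' -> v = v'.
Proof.
elim: w u => [|a w IH] u /=; first by move=> <-.
by case=> c uc cv [c' uc' cv']; move: cv; rewrite (letter_edge_fun uc uc') => /IH; exact.
Qed.

Lemma trace_cat w w' u v :
  trace (w ++ w') u v <-> exists2 c, trace w u c & trace w' c v.
Proof.
elim: w u => [|a w IH] u /=; first by split=> [h|[c ->]//]; exists u.
split=> [[c uc /IH[d cd dv]]|[d [c uc cd] dv]].
  by exists d => //; exists c.
by exists c => //; apply/IH; exists d.
Qed.

Lemma trace_rcons w a u v :
  trace (rcons w a) u v <-> exists2 c, trace w u c & letter_edge a c v.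
Proof.
rewrite -cats1; split=> [/trace_cat[c uc /= [d cd <-]]|[c uc cv]]; first by exists c.
by apply/trace_cat; exists c => //=; exists v.
Qed.

Lemma trace_inv w u v : trace (word_inv w) u v <-> trace w v u.
Proof.
elim: w u v => [|[s b] w IH] u v; first by split=> ->.
rewrite /word_inv /= rev_cons; split=> [/trace_rcons[c /IH cu /letter_edge_inv]|[c vc /IH uc]].
  by exists c.
by apply/trace_rcons; exists c => //; apply/letter_edge_inv.
Qed.

Lemma walk_trace k u v : walk k u v <-> exists2 w, size w = k & trace w u v.
Proof.
elim: k v => [|k IH] v /=.
  by split=> [->|[w /size0nil -> //]]; exists [::].
split=> [[c /IH[w wk uc] /adj_letter[a cv]]|[w]].
  by exists (rcons w a); [rewrite size_rcons wk|apply/trace_rcons; exists c].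
case/lastP: w => // w a; rewrite size_rcons => -[wk] /trace_rcons[c uc cv].
by exists c; [apply/IH; exists w|apply/adj_letter; exists a].
Qed.

Lemma gball_trace r u v : gball u r v <-> exists2 w, (size w <= r)%N & trace w u v.
Proof.
split=> [[k kr /walk_trace[w wk uv]]|[w wr uv]]; first by exists w => //; rewrite wk.
by exists (size w) => //; apply/walk_trace; exists w.
Qed.

End trace_theory.

Definition loop (G : pmgraph) (w : word) : Prop := trace w (base G) (base G).

Lemma size_word_inv w : size (word_inv w) = size w.
Proof. by rewrite size_rev size_map. Qed.

Lemma trace_ball r G H (f : graph G -> graph H) : f (base G) = base H ->
  (forall s y z, gball (base G) r y -> gball (base G) r z ->
     (edge s y z -> edge s (f y) (f z))) ->
  forall w v, (size w <= r)%N -> trace w (base G) v -> trace w (base H) (f v).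
Proof.
move=> fb fe; elim/last_ind => [|w a IH] v; first by move=> _ /= <-.
rewrite size_rcons => wr /trace_rcons[c bc cv].
apply/trace_rcons; exists (f c); first exact: IH (ltnW wr) bc.
have cr : gball (base G) r c by apply/gball_trace; exists w => //; exact: ltnW.
have vr : gball (base G) r v.
  by apply/gball_trace; exists (rcons w a); rewrite ?size_rcons //; apply/trace_rcons; exists c.
by case: a cv => s [] /= ?; exact: fe.
Qed.

Lemma ball_isom_loop r G H w :
  (size w <= r)%N -> ball_isom r G H -> loop G w -> loop H w.
Proof.
move=> wr [f [_ fb fe]] /(trace_ball fb _ wr); rewrite fb; apply.
by move=> s y z yr zr /fe; apply.
Qed.

(** Two words lead to the same vertex, or to the two ends of an edge, when
    a word that first follows one of them and then the reverse of the other
    (with the edge in between) is closed. So the closed words of length at most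
    2r + 1 contain a complete description of the ball of radius r. *)
Lemma loop_ball_isom r (G H : pmgraph) :
  (forall w, (size w <= r.*2.+1)%N -> loop G w <-> loop H w) -> ball_isom r G H.
Proof.
move=> GH.
have eqv (A B : pmgraph) : (forall w, (size w <= r.*2.+1)%N -> loop A w -> loop B w) ->
    forall w1 w2 x y1 y2, (size w1 <= r)%N -> (size w2 <= r)%N ->
    trace w1 (base A) x -> trace w2 (base A) x ->
    trace w1 (base B) y1 -> trace w2 (base B) y2 -> y1 = y2.
  move=> AB w1 w2 x y1 y2 s1 s2 x1 x2 t1 t2.
  have /trace_cat[c c1 /trace_inv c2] : loop B (w1 ++ word_inv w2).
    apply: AB; first by rewrite size_cat size_word_inv; lia.
    by apply/trace_cat; exists x => //; apply/trace_inv.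
  by rewrite (trace_fun t1 c1) (trace_fun t2 c2).
have edg (A B : pmgraph) : (forall w, (size w <= r.*2.+1)%N -> loop A w -> loop B w) ->
    forall s w1 w2 x1 x2 y1 y2, (size w1 <= r)%N -> (size w2 <= r)%N ->
    trace w1 (base A) x1 -> trace w2 (base A) x2 ->
    trace w1 (base B) y1 -> trace w2 (base B) y2 -> edge s x1 x2 -> edge s y1 y2.
  move=> AB s w1 w2 x1 x2 y1 y2 s1 s2 t1 t2 t1' t2' x12.
  have /trace_cat[c c1 /= [d cd /trace_inv d2]] :
      loop B (w1 ++ (s, true) :: word_inv w2).
    apply: AB; first by rewrite size_cat /= size_word_inv; lia.
    apply/trace_cat; exists x1 => //=; exists x2 => //; exact/trace_inv.
  by rewrite (trace_fun t1' c1) (trace_fun t2' d2).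
have GH1 w : (size w <= r.*2.+1)%N -> loop G w -> loop H w by move=> /GH[].
have HG1 w : (size w <= r.*2.+1)%N -> loop H w -> loop G w by move=> /GH[].
(* A vertex of the ball of A goes to the vertex of B reached by the same word. *)
have transfer (A B : pmgraph) : exists f : graph A -> graph B, forall x,
    gball (base A) r x -> exists w, [/\ (size w <= r)%N, trace w (base A) x &
      trace w (base B) (f x)].
  suff /choice[f fP] : forall x, exists y, gball (base A) r x -> exists w,
      [/\ (size w <= r)%N, trace w (base A) x & trace w (base B) y] by exists f.
  move=> x.
  have [/gball_trace[w wr wx]|nx] := pselect (gball (base A) r x).
    by have [y wy] := trace_total w (base B); exists y => _; exists w.
  by exists (base B) => /nx.
have [f fP] := transfer G H; have [g gP] := transfer H G.
have cancel (A B : pmgraph) (h : graph A -> graph B) (k : graph B -> graph A) :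
    (forall w, (size w <= r.*2.+1)%N -> loop B w -> loop A w) ->
    (forall x, gball (base A) r x -> exists w, [/\ (size w <= r)%N,
      trace w (base A) x & trace w (base B) (h x)]) ->
    (forall x, gball (base B) r x -> exists w, [/\ (size w <= r)%N,
      trace w (base B) x & trace w (base A) (k x)]) ->
    forall x, gball (base A) r x -> gball (base B) r (h x) /\ k (h x) = x.
  move=> BA hP kP x /hP[w [wr wx wh]].
  have hx : gball (base B) r (h x) by apply/gball_trace; exists w.
  split=> //; have [w' [wr' wh' wk]] := kP _ hx.
  exact: (eqv B A BA w' w (h x)).
apply: (@ball_isom_mk r G H f g).
- have [w [wr wb wfb]] := fP _ (gball_base (base G) r).
  exact: (eqv G H GH1 w [::] (base G)).
- exact: cancel.
- exact: cancel.
- move=> s y z /fP[w1 [r1 y1 fy1]] /fP[w2 [r2 z2 fz2]]; split.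
    exact: (edg G H GH1 s w1 w2).
  exact: (edg H G HG1 s w1 w2).
Qed.

Section mgspace_loops.
Variable R : realType.
Implicit Types (x y : mgspace R).

Definition loops x : set word := loop (mgrepr x).

Lemma loops_mgclass (G : pmgraph) w : loops (mgclass R G) w <-> loop G w.
Proof.
have iso : pm_isom (mgrepr (mgclass R G)) G by apply/(mgclassP R); rewrite mgreprK.
split; apply: (@ball_isom_loop (size w)) => //; apply: pm_isom_ball => //.
exact: pm_isom_sym.
Qed.

Definition agree n x y := forall w, (size w <= n)%N -> loops x w <-> loops y w.

Lemma agree_le m n x y : (m <= n)%N -> agree n x y -> agree m x y.
Proof. by move=> mn xy w /leq_trans/(_ mn)/xy. Qed.

Lemma loops_inj x y : (forall w, loops x w <-> loops y w) -> x = y.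
Proof.
move=> xy; rewrite -(mgreprK x) -(mgreprK y); apply/mgclassP.
by apply: ball_isom_all => r; apply: loop_ball_isom => w _; exact: xy.
Qed.

Lemma nbhs_agreeP x (A : set (mgspace R)) :
  nbhs x A <-> exists n, agree n x `<=` A.
Proof.
split=> [|[n nA]].
  case/nbhs_ballP => e /= e0 eA.
  have [k ke] : exists k : nat, (2 ^ (1 - k%:Z) : R) < e.
    have [k _ /(_ k (leqnn k)) /= ke] := near_infty_natSinv_expn_lt (PosNum e0).
    exists k.+1; have -> : 1 - k.+1%:Z = - k%:Z by lia.
    by rewrite -exprnN -div1r.
  exists k.*2.+1 => y xy; apply: eA; rewrite ballEmdist /=; apply: lt_trans ke.
  by apply/pm_dist_lt/loop_ball_isom.
apply/nbhs_ballP; exists (2 ^ (1 - n%:Z)); first exact: exprz_gt0.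
rewrite ballEmdist => y /pm_dist_lt xy; apply: nA => w wn; split.
  exact: ball_isom_loop xy.
exact/(ball_isom_loop wn)/ball_isom_sym.
Qed.

End mgspace_loops.

(** * Cylinders and dyadic intervals *)

Definition cyl_take (u : cantor_space) (n : nat) : seq bool := mkseq u n.

Definition cyl_drop (u : cantor_space) (n : nat) : cantor_space := fun i => u (n + i)%N.

Lemma prepend_take_drop u n : u = prepend (cyl_take u n) (cyl_drop u n).
Proof.
apply: funext => i; rewrite /prepend size_mkseq; case: ltnP => [ni|ni].
  by rewrite nth_mkseq.
by rewrite /cyl_drop subnKC.
Qed.

Lemma cyl_take_prepend p z : cyl_take (prepend p z) (size p) = p.
Proof.
apply: (@eq_from_nth _ false); rewrite size_mkseq // => i ip.
by rewrite nth_mkseq // /prepend ip.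
Qed.

Lemma cyl_take_prepend_cat p z m : cyl_take (prepend p z) (size p + m) = p ++ cyl_take z m.
Proof.
rewrite {1}(prepend_take_drop z m) -prepend_cat.
by have := cyl_take_prepend (p ++ cyl_take z m) (cyl_drop z m); rewrite size_cat size_mkseq.
Qed.

Lemma cyl_takeD u n m : cyl_take u (n + m) = cyl_take u n ++ cyl_take (cyl_drop u n) m.
Proof.
have := cyl_take_prepend_cat (cyl_take u n) (cyl_drop u n) m.
by rewrite -prepend_take_drop size_mkseq.
Qed.

Lemma take_cyl_take u m n : (m <= n)%N -> take m (cyl_take u n) = cyl_take u m.
Proof.
move=> mn; apply: (@eq_from_nth _ false); rewrite size_takel ?size_mkseq // => i im.
by rewrite nth_take // !nth_mkseq // (leq_trans im).
Qed.

Lemma cantor_eq (u v : cantor_space) :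
  (forall n, cyl_take u n = cyl_take v n) -> u = v.
Proof.
move=> uv; apply: funext => i; have := congr1 (nth false ^~ i) (uv i.+1).
by rewrite !nth_mkseq.
Qed.

Section dyadic_intervals.
Variable R : realType.
Implicit Types (p q r : seq bool) (x t : R) (f g : R -> R).

(** The interior of the set of numbers with a binary expansion starting with p.
    Openness matters: a dyadic number is in no such interval for long p. *)
Definition inside p x : Prop :=
  word_val R p < x < word_val R p + 2 ^- size p.

Lemma exp2_gt0 n : 0 < (2 ^- n : R).
Proof. by rewrite invr_gt0 exprn_gt0. Qed.

Lemma word_val_le p : word_val R p + 2 ^- size p <= 1.
Proof.
elim: p => [|b p IH] /=; first by rewrite expr0; lra.
have -> : (2 : R) ^- (size p).+1 = 2 ^- size p / 2.
  by rewrite exprS; field; rewrite expf_neq0.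
by case: b => /=; lra.
Qed.

Lemma insideE p x : inside p x <-> exists2 t, 0 < t < 1 & x = word_val R p + t / 2 ^+ size p.
Proof.
have h := exp2_gt0 (size p).
split=> [/andP[px xp]|[t /andP[t0 t1] ->]]; last first.
  rewrite /inside ltrDl mulr_gt0 //= ltrD2l.
  by rewrite -[ltRHS]mul1r ltr_pM2r.
exists ((x - word_val R p) / 2 ^- size p); last first.
  by field; rewrite expf_neq0.
by rewrite divr_gt0 ?ltr_pdivrMr //=; lra.
Qed.

Lemma inside_cat p r x : inside (p ++ r) x -> inside p x.
Proof.
rewrite /inside word_val_cat size_cat exprD invfM.
have := exp2_gt0 (size p); move: (2 ^- size p) => a a0.
have := word_val01 R r; have := word_val_le r.
move: (word_val R r) (2 ^- size r) => b c h1 /andP[h2 h3] /andP[h4 h5].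
by apply/andP; split; nra.
Qed.

Lemma word_val_int p : exists m : nat, word_val R p = m%:R / 2 ^+ size p.
Proof.
elim: p => [|b p [m IH]] /=; first by exists 0%N; rewrite mul0r.
exists (b * 2 ^ size p + m)%N; rewrite IH natrD natrM natrX exprS.
by field; rewrite expf_neq0.
Qed.

(** The left ends of the intervals of one level are integer multiples of the
    common length of these intervals. *)
Lemma inside_level_inj p p' x : size p = size p' -> inside p x -> inside p' x -> p = p'.
Proof.
move=> pp' ix ix'; apply: (@word_val_inj R) => //.
have h := exp2_gt0 (size p).
move: ix ix'; rewrite /inside -pp'.
have [m ->] := word_val_int p; have [m' ->] := word_val_int p'.
rewrite -pp' => /andP[h1 h2] /andP[h3 h4].
suff -> : m = m' by [].
have lt1 : (m%:R : R) < m'%:R + 1.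
  by rewrite -(ltr_pM2r h) mulrDl mul1r; apply: lt_trans h1 h4.
have lt2 : (m'%:R : R) < m%:R + 1.
  by rewrite -(ltr_pM2r h) mulrDl mul1r; apply: lt_trans h3 h2.
by move: lt1 lt2; rewrite !natr1 !ltr_nat; lia.
Qed.

Lemma inside_take p n x : inside p x -> inside (take n p) x.
Proof. by move=> h; apply: (@inside_cat _ (drop n p)); rewrite cat_take_drop. Qed.

Lemma inside_prefix p p' x : (size p <= size p')%N ->
  inside p x -> inside p' x -> take (size p) p' = p.
Proof.
move=> pp' ix ix'; apply: (@inside_level_inj _ _ x) => //.
  by rewrite size_takel.
exact: inside_take.
Qed.

Lemma inside_or_level n x : 0 < x < 1 ->
  (exists2 p, size p = n & inside p x) \/ exists m : nat, x = m%:R / 2 ^+ n.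
Proof.
elim: n x => [|n IH] x x01.
  by left; exists [::] => //; rewrite /inside /= expr0; lra.
have [x2|x2|x2] := ltgtP x (1 / 2).
- have [|[p pn px]|[m xm]] := IH (2 * x); first lra.
    left; exists (false :: p); rewrite /= ?pn //.
    by move: px; rewrite /inside /= exprS invfM; move: (2 ^- _) => a; lra.
  right; exists m; rewrite exprS; apply: (@mulfI _ 2) => //; rewrite xm.
  by field; rewrite expf_neq0.
- have [|[p pn px]|[m xm]] := IH (2 * x - 1); first lra.
    left; exists (true :: p); rewrite /= ?pn //.
    by move: px; rewrite /inside /= exprS invfM; move: (2 ^- _) => a; lra.
  right; exists (m + 2 ^ n)%N; rewrite exprS natrD natrX.
  have -> : x = (2 * x - 1 + 1) / 2 by lra.
  by rewrite xm; field; rewrite expf_neq0.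
right; exists (2 ^ n)%N; rewrite x2 natrX exprS.
by field; rewrite expf_neq0.
Qed.

Lemma level_not_inside n (m : nat) p x :
  (n <= size p)%N -> x = m%:R / 2 ^+ n -> ~ inside p x.
Proof.
move=> np xm; rewrite /inside; have [k ->] := word_val_int p.
have -> : x = (m * 2 ^ (size p - n))%N%:R / 2 ^+ size p.
  rewrite xm natrM natrX -{2}(subnK np) exprD.
  by field; rewrite !expf_neq0.
move: (m * _)%N => l; have h := exp2_gt0 (size p).
rewrite -[X in _ + X]mul1r -mulrDl !ltr_pM2r // natr1 !ltr_nat; lia.
Qed.

(** * Piecewise affine maps between cylinders *)

Lemma word_val_itv p t : 0 <= t <= 1 -> 0 <= word_val R p + t / 2 ^+ size p <= 1.
Proof.
move=> /andP[t0 t1]; have h := exp2_gt0 (size p).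
have := word_val_le p; have := word_val01 R p.
have : 0 <= t / 2 ^+ size p by rewrite mulr_ge0 // ltW.
have : t / 2 ^+ size p <= 2 ^- size p by rewrite -[leRHS]mul1r ler_pM2r.
lra.
Qed.

Lemma maps_cylinder_comp f g p q r :
  maps_cylinder f p q -> maps_cylinder g q r -> maps_cylinder (g \o f) p r.
Proof. by move=> fpq gqr t t01 /=; rewrite fpq // gqr. Qed.

Lemma maps_cylinder_tinv f p q : is_thompson f ->
  maps_cylinder f p q -> maps_cylinder (tinv f) q p.
Proof. by move=> tf fpq t t01; rewrite -fpq // tinvK //; exact: word_val_itv. Qed.

Lemma maps_cylinder_inside_hom f p q x :
  maps_cylinder f p q -> inside p x -> inside q (f x).
Proof.
move=> fpq /insideE[t t01 ->]; apply/insideE; exists t => //.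
by rewrite fpq //; lra.
Qed.

Lemma maps_cylinder_inside f p q x : is_thompson f -> 0 <= x <= 1 ->
  maps_cylinder f p q -> inside p x <-> inside q (f x).
Proof.
move=> tf x01 fpq; split; first exact: maps_cylinder_inside_hom.
move/(maps_cylinder_inside_hom (maps_cylinder_tinv tf fpq)).
by rewrite tinvK.
Qed.

Lemma word_val_surj d (m : nat) : (m < 2 ^ d)%N ->
  exists2 p, size p = d & word_val R p = m%:R / 2 ^+ d.
Proof.
elim: d m => [|d IH] m.
  by rewrite expn0 ltnS leqn0 => /eqP->; exists [::]; rewrite //= mul0r.
rewrite expnS => md; have [m2|m2] := ltnP m (2 ^ d).
  have [p pd pm] := IH m m2; exists (false :: p); rewrite /= ?pd // pm exprS.
  by field; rewrite expf_neq0.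
have [|p pd pm] := IH (m - 2 ^ d)%N; first lia.
exists (true :: p); rewrite /= ?pd // pm exprS natrB // natrX.
by field; rewrite expf_neq0.
Qed.

Lemma dyadic_seq (s : seq R) : (forall x, x \in s -> dyadic x) ->
  exists n, forall x, x \in s -> exists m : int, x = m%:~R / 2 ^+ n.
Proof.
elim: s => [|y s IH] sd; first by exists 0%N.
have [|n nP] := IH; first by move=> x xs; apply: sd; rewrite inE xs orbT.
have [m [k yk]] := sd y (mem_head _ _).
exists (n + k)%N => x; rewrite inE => /orP[/eqP->|/nP[l ->]].
  exists (m * 2 ^+ n); rewrite yk intrM rmorphXn /= exprD.
  by field; rewrite !expf_neq0.
exists (l * 2 ^+ k); rewrite intrM rmorphXn /= exprD.
by field; rewrite !expf_neq0.
Qed.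

(** If all breakpoints are multiples of 1 / 2 ^ n, then f is affine, of slope
    2 ^ k, on the interval of the first n digits of u. Longer prefixes of u have
    shorter intervals; when these are short enough, their images have some length
    1 / 2 ^ d and start at a multiple of 1 / 2 ^ d, which makes them intervals of
    words of length d. *)
Lemma thompson_maps_cylinder f (u : cantor_space) : is_thompson f ->
  exists n q, maps_cylinder f (cyl_take u n) q.
Proof.
move=> tf; have [s /dyadic_seq[n nP] sP] := thompson_pl tf.
have h := exp2_gt0.
set p := cyl_take u n; have sp : size p = n by rewrite size_mkseq.
have [|||x xs xp|k [c kc]] := sP (word_val R p) (word_val R p + 2 ^- n).
- by case/andP: (word_val01 R p).
- by rewrite ltrDl.
- by have := word_val_le p; rewrite sp.
- have [m xm] := nP _ xs.
  have x0 : 0 < x by have := word_val01 R p; lra.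
  have m0 : 0 <= m by move: x0; rewrite xm pmulr_lgt0 // ltr0z => /ltW.
  apply: (@level_not_inside n (absz m) p x); rewrite ?sp //.
    by rewrite xm -(@gez0_abs m).
  by rewrite /inside sp.
have dp : dyadic (f (word_val R p)).
  rewrite -(thompson_dyadic tf); last by have := word_val01 R p; lra.
  by have [m ->] := word_val_int p; exact: dyadic_nat.
have [m [e fpe]] := dp.
(* The length N makes d = N - k at least e, the level of f (word_val p). *)
pose N := (n + absz k + e)%N.
have [d dE] : exists d : nat, d%:Z = N%:Z - k by exists (absz (N%:Z - k)); lia.
have ed : (e <= d)%N by lia.
set p' := cyl_take u N; have sp' : size p' = N by rewrite size_mkseq.
have [r rP] : exists r, p' = p ++ r.
  exists (cyl_take (cyl_drop u n) (N - n)); rewrite -cyl_takeD; congr cyl_take; lia.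
have sr : (size p + size r)%N = N by rewrite -size_cat -rP.
have pow : (2 : R) ^ k / 2 ^+ N = 2 ^- d.
  have -> : k = N%:Z - d%:Z by lia.
  rewrite expfzDr ?pnatr_eq0 // -exprnP -exprnN.
  by field; rewrite !expf_neq0.
have itv t' : 0 <= t' <= 1 -> word_val R p <= word_val R p' + t' / 2 ^+ size p'
    <= word_val R p + 2 ^- n.
  move=> t'01; rewrite rP word_val_cat size_cat exprD.
  have -> : word_val R p + word_val R r / 2 ^+ size p + t' / (2 ^+ size p * 2 ^+ size r)
    = word_val R p + (word_val R r + t' / 2 ^+ size r) / 2 ^+ size p.
    by field; rewrite !expf_neq0.
  rewrite sp; have /andP[h1 h2] := word_val_itv r t'01.
  by rewrite lerDl mulr_ge0 ?(ltW (h n)) //= lerD2l -[leRHS]mul1r ler_pM2r.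
have aff t : 0 <= t <= 1 ->
    f (word_val R p' + t / 2 ^+ size p') = f (word_val R p') + t / 2 ^+ d.
  move=> t01.
  rewrite kc ?itv // -[in RHS](addr0 (word_val R p')).
  rewrite -[in RHS](mul0r (2 ^+ size p')^-1) kc ?itv ?lexx ?ler01 // sp'.
  by rewrite mul0r addr0 mulrDr addrAC mulrCA pow.
have [l fl] : exists l : int, f (word_val R p') = l%:~R / 2 ^+ d.
  have [i ri] := word_val_int r; exists (m * 2 ^+ (d - e) + i%:Z).
  have -> : f (word_val R p') = f (word_val R p) + i%:R * 2 ^- d.
    have := itv 0; rewrite lexx ler01 mul0r addr0 => /(_ isT) wp'.
    rewrite kc // kc; last by rewrite lexx lerDl ltW.
    rewrite -pow -sr exprD rP word_val_cat ri.
    by field; rewrite !expf_neq0.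
  have -> : (2 : R) ^+ d = 2 ^+ (d - e) * 2 ^+ e by rewrite -exprD subnK.
  rewrite fpe intrD intrM rmorphXn /=.
  by field; rewrite !expf_neq0.
have fp01 : 0 <= f (word_val R p') <= 1.
  by apply: thompson_in => //; have := word_val01 R p'; lra.
have l0 : 0 <= l.
  by move: fp01; rewrite fl pmulr_lge0 ?h // ler0z => /andP[].
have ld : (absz l < 2 ^ d)%N.
  have : f (word_val R p' + 1 / 2 ^+ size p') <= 1.
    by have /andP[] := thompson_in tf (word_val_itv p' (t := 1) ltac:(lra)).
  rewrite aff ?ler01 ?lexx // fl -mulrDl ler_pdivrMr ?exprn_gt0 // mul1r.
  by rewrite -(gez0_abs l0) -natrX -pmulrn natr1 ler_nat.
have [q qd ql] := word_val_surj ld.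
exists N, q => t t01; rewrite aff // qd ql fl.
by rewrite -{1}(gez0_abs l0).
Qed.

End dyadic_intervals.

(** * Words acting on the unit interval *)

Section word_maps.
Variable R : realType.
Implicit Types (p q c : seq bool) (x y : R) (w h : word).

Lemma is_thompson_id : is_thompson (@id R).
Proof.
apply: (@is_thompson_mk _ _ id) => //.
exists [::] => // a b _ _ _ _; exists 0, 0 => t _.
by rewrite expr0z mul1r addr0.
Qed.

Definition letter_map (a : gen * bool) : thompson R :=
  if a.2 then gen_map R a.1 else thompson_inv (gen_map R a.1).

Fixpoint word_map w : thompson R :=
  if w is a :: w' then thompson_comp (word_map w') (letter_map a)
  else Thompson is_thompson_id.

Lemma word_map_cat w w' x : word_map (w ++ w') x = word_map w' (word_map w x).
Proof. by elim: w x => [|a w IH] x //=; rewrite IH. Qed.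

Lemma word_map01 w x : 0 <= x <= 1 -> 0 <= word_map w x <= 1.
Proof. exact/thompson_in/thompsonP. Qed.

Lemma letter_map_inv a x y : 0 <= x <= 1 -> 0 <= y <= 1 ->
  letter_map (a.1, ~~ a.2) x = y <-> letter_map a y = x.
Proof.
have tK (f : thompson R) z z' : 0 <= z <= 1 -> 0 <= z' <= 1 ->
    thompson_inv f z = z' <-> f z' = z.
  move=> z01 z'01; split=> [<-|<-] /=; last by rewrite tinvK //; exact: thompsonP.
  by have [] := tinvP (thompsonP f) z01.
case: a => s [] x01 y01; rewrite /letter_map /=; first exact: (tK (gen_map R s)).
by symmetry; exact: (tK (gen_map R s)).
Qed.

Lemma word_map_inv w x y : 0 <= x <= 1 -> 0 <= y <= 1 ->
  word_map (word_inv w) x = y <-> word_map w y = x.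
Proof.
elim: w x y => [|a w IH] x y x01 y01; first by rewrite /word_inv /=; split=> ->.
have ay01 : 0 <= letter_map a y <= 1 by exact: (thompson_in (thompsonP _)).
rewrite /word_inv /= rev_cons -cats1 word_map_cat /=.
rewrite letter_map_inv //; last exact: word_map01.
by rewrite -(IH x) //; split=> ->.
Qed.

Lemma word_map_surj w x : 0 <= x <= 1 -> exists2 y, 0 <= y <= 1 & word_map w y = x.
Proof. exact/thompson_surj/thompsonP. Qed.

(** ** Words supported on a dyadic interval *)

Definition moves_exactly w (A : set R) : Prop :=
  forall x, 0 <= x <= 1 -> word_map w x = x <-> ~ A x.

(** The word h w h^-1 fixes x when w fixes the image of x under h. *)
Lemma moves_exactly_conj w h (A B : set R) :
  (forall x, 0 <= x <= 1 -> A x <-> B (word_map h x)) ->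
  moves_exactly w B -> moves_exactly (h ++ w ++ word_inv h) A.
Proof.
move=> AB wB x x01; rewrite !word_map_cat word_map_inv ?word_map01 //.
rewrite AB // -wB ?word_map01 //; split=> /esym; exact.
Qed.

Local Notation a := (X0, true).
Local Notation a' := (X0, false).
Local Notation b := (X1, true).
Local Notation b' := (X1, false).

Lemma moves_x0 : moves_exactly [:: a] (inside [::]).
Proof.
move=> x x01; rewrite /inside /= /x0_fun expr0 invr1 add0r.
by split; do ![case: ifPn]; move: x01; case: (ltP 0 x); case: (ltP x 1); lra.
Qed.

Lemma moves_x1 : moves_exactly [:: b] (inside [:: true]).
Proof.
move=> x x01; rewrite /inside /= /x1_fun expr1.
by split; do ![case: ifPn]; move: x01; lra.
Qed.

(** The word x0 x1^-1 fixes x when x0 and x1 agree at x. This holds at 0 and,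
    as both maps are 2x - 1 near 1, from 7 / 8 on. *)
Lemma moves_x0x1V : moves_exactly [:: a; b'] [set x | 0 < x < 7 / 8].
Proof.
move=> x x01; rewrite /= (letter_map_inv b) ?(word_map01 [:: a]) //=.
by rewrite /x0_fun /x1_fun; split; do ![case: ifPn]; lra.
Qed.

(** The commutator x1 x0 x1^-1 x0^-1 fixes x when x0 and x1 commute at x. *)
Lemma moves_commutator : moves_exactly [:: b; a; b'; a'] [set x | 1 / 2 < x < 15 / 16].
Proof.
move=> x x01; rewrite -[[:: b; _; _; _]]/([:: b; a] ++ word_inv [:: a; b]) word_map_cat.
rewrite word_map_inv ?word_map01 //=.
by rewrite /x0_fun /x1_fun; split; do ![case: ifPn]; lra.
Qed.

(** The square of x0 maps (0, 7 / 8) to (0, 3 / 4) and then to (0, 1 / 2). *)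
Lemma moves_left_half : exists w, moves_exactly w (inside [:: false]).
Proof.
eexists; apply: (moves_exactly_conj (h := [:: a'; a'])) moves_x0x1V => x x01.
have [y y01 <-] := word_map_surj [:: a; a] x01.
rewrite [word_map [:: a'; a'] _](iffRL (@word_map_inv [:: a; a] _ _ _ _) erefl) ?word_map01 //.
by rewrite /inside /= /x0_fun expr1; split; do ![case: ifPn]; lra.
Qed.

(** The square of x1 maps (1 / 2, 15 / 16) to (1 / 2, 7 / 8) and then to
    (1 / 2, 3 / 4). *)
Lemma moves_third_quarter : exists w, moves_exactly w (inside [:: true; false]).
Proof.
eexists; apply: (moves_exactly_conj (h := [:: b'; b'])) moves_commutator => x x01.
have [y y01 <-] := word_map_surj [:: b; b] x01.
rewrite [word_map [:: b'; b'] _](iffRL (@word_map_inv [:: b; b] _ _ _ _) erefl) ?word_map01 //.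
by rewrite /inside /= /x1_fun expr2; split; do ![case: ifPn]; lra.
Qed.

(** ** Every dyadic interval can be moved to one of three intervals *)

(** An interval with end 0, one with end 1, and one away from both ends: elements
    of F fix 0 and 1, so these three cases cannot be reduced to each other. *)
Definition model_cylinder c : Prop :=
  [\/ c = [:: false], c = [:: true] | c = [:: true; false]].

Lemma maps_cylinder_x0 :
  [/\ maps_cylinder (gen_map R X0) [:: false] [:: false; false],
      maps_cylinder (gen_map R X0) [:: true; false] [:: false; true] &
      maps_cylinder (gen_map R X0) [:: true; true] [:: true]].
Proof.
by split=> t t01; rewrite /= /x0_fun ?expr1 ?expr2; do ![case: ifPn]; lra.
Qed.

Lemma maps_cylinder_x1 :
  maps_cylinder (gen_map R X1) [:: true; false] [:: true; false; false] /\
  maps_cylinder (gen_map R X1) [:: true; true; false] [:: true; false; true].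
Proof.
by split=> t t01; rewrite /= /x1_fun !exprS expr0; do ![case: ifPn]; lra.
Qed.

Lemma maps_cylinder_letterV s p q : maps_cylinder (gen_map R s) p q ->
  maps_cylinder (letter_map (s, false)) q p.
Proof. exact/maps_cylinder_tinv/thompsonP. Qed.

(** Appending a digit to a model cylinder gives a cylinder that at most two
    generators or their inverses map onto a model cylinder again, so p can be read digit by digit. *)
Lemma maps_cylinder_model p : p != [::] ->
  exists2 c, model_cylinder c & exists w, maps_cylinder (word_map w) p c.
Proof.
have [x00 x010 x011] := maps_cylinder_x0; have [x110 x1110] := maps_cylinder_x1.
elim/last_ind: p => // p d IH _; have [p0|p0] := eqVneq p [::].
  exists [:: d]; last by exists [::]; rewrite p0 => t t01.
  by case: d; [constructor 2|constructor 1].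
have [c cm [w wp]] := IH p0.
(* It suffices to move the extension of the model cylinder by one more digit. *)
have step w' c' : maps_cylinder (word_map w') (rcons c d) c' ->
    exists w, maps_cylinder (word_map w) (rcons p d) c'.
  move=> w'c; exists (w ++ w') => t t01; rewrite word_map_cat.
  by move: t t01; apply: maps_cylinder_comp w'c; rewrite -!cats1; exact: maps_cylinder_cat.
have one l q q' : maps_cylinder (letter_map l) q q' -> maps_cylinder (word_map [:: l]) q q'.
  by [].
case: cm step => -> step; case: d step => /= step.
- exists [:: true; false]; first by constructor 3.
  by apply: (step [:: a']); apply/one/maps_cylinder_letterV.
- exists [:: false]; first by constructor 1.
  by apply: (step [:: a']); apply/one/maps_cylinder_letterV.
- exists [:: true]; first by constructor 2.
  by apply: (step [:: a]); apply/one.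
- exists [:: true; false]; first by constructor 3.
  by apply: (step [::]) => t t01.
- exists [:: true; false]; first by constructor 3.
  apply: (step [:: b'; a]); apply: (@maps_cylinder_comp _ _ _ _ [:: true; true; false]).
    exact: maps_cylinder_letterV.
  by apply/one; exact: (maps_cylinder_cat [:: false] x011).
- exists [:: true; false]; first by constructor 3.
  by apply: (step [:: b']); apply/one/maps_cylinder_letterV.
Qed.

(** The elements of F that act on a single dyadic interval: conjugates of those
    for the model cylinders, and x0 for the whole interval. *)
Lemma moves_exactly_inside p : exists w, moves_exactly w (inside p).
Proof.
have [->|p0] := eqVneq p [::]; first by exists [:: a]; exact: moves_x0.
have [c cm [h hp]] := maps_cylinder_model p0.
have [w wc] : exists w, moves_exactly w (inside c).
  case: cm => ->.
  - exact: moves_left_half.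
  - by exists [:: b]; exact: moves_x1.
  - exact: moves_third_quarter.
exists (h ++ w ++ word_inv h); apply: moves_exactly_conj wc => x x01.
by apply: maps_cylinder_inside hp => //; exact: thompsonP.
Qed.

(** The orbit of 1 / 2 contains 1 / 4, 3 / 4 and 5 / 8, one point in each model
    interval, and hence meets every dyadic interval. *)
Lemma half_orbit_inside p : exists q : half_vertex R, inside p (sval q).
Proof.
have [->|p0] := eqVneq p [::].
  by exists (Defs.half R); rewrite /inside /= expr0; lra.
have [c cm [w wp]] := maps_cylinder_model p0.
have [q qc] : exists q : half_vertex R, inside c (sval q).
  have [q3 q3E] : exists q3 : half_vertex R, sval q3 = 3 / 4.
    exists (orbit_act (thompson_inv (gen_map R X0)) (Defs.half R)); move: (orbit_act _ _)
      (half_orbit01 (orbit_act (thompson_inv (gen_map R X0)) (Defs.half R)))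
      (congr1 sval (orbit_actVK (gen_map R X0) (Defs.half R))) => q3 /=.
    by rewrite /x0_fun; do ![case: ifPn]; lra.
  case: cm => ->.
  - exists (orbit_act (gen_map R X0) (Defs.half R)).
    by rewrite /inside /= /x0_fun expr1; case: ifPn; lra.
  - by exists q3; rewrite /inside q3E /= expr1; lra.
  - exists (orbit_act (gen_map R X1) q3).
    by rewrite /inside /= q3E /x1_fun expr2; do ![case: ifPn]; lra.
pose q' := orbit_act (thompson_inv (word_map w)) q; exists q'.
have q'01 := half_orbit01 q'.
apply/(maps_cylinder_inside (thompsonP (word_map w)) _ wp); first lra.
by have /= -> := congr1 sval (orbit_actVK (word_map w) q).
Qed.

Lemma trace_schreier w (q q' : schreier_graph R) :
  trace w q q' <-> word_map w (sval q) = sval q'.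
Proof.
have v01 (v : half_vertex R) : 0 <= sval v <= 1 by have := half_orbit01 v; lra.
have edgeE l (u v : schreier_graph R) :
    letter_edge l u v <-> letter_map l (sval u) = sval v.
  case: l => s [] //; rewrite -[(s, false)]/(((s, true).1, ~~ (s, true).2)).
  by rewrite letter_map_inv.
elim: w q => [|l w IH] q /=.
  by split=> [->//|h]; exact: half_vertex_inj.
split=> [[c /edgeE qc /IH cv]|h]; first by rewrite qc.
by exists (orbit_act (letter_map l) q); [apply/edgeE|apply/IH].
Qed.

Lemma loops_schreier (q : half_vertex R) w :
  loops (schreier_pt q) w <-> word_map w (sval q) = sval q.
Proof. by rewrite loops_mgclass -trace_schreier. Qed.

End word_maps.

(** * Graphs of germs *)

Section component.
Variable G : marked_graph.
Variable u0 : G.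

Definition component_vertex : Type := {v : G | conn u0 v}.

Lemma component_vertex_inj (y z : component_vertex) : sval y = sval z -> y = z.
Proof. by case: y z => [y yP] [z zP] /= yz; exact: eq_exist. Qed.

Lemma component_out s (y : component_vertex) :
  exists! z : component_vertex, edge s (sval y) (sval z).
Proof.
have [z [yz zP]] := edge_out s (sval y).
have cz : conn u0 z by apply: conn_adj (svalP y) _; exists s; left.
by exists (exist _ z cz); split=> // z' /zP zz'; exact: component_vertex_inj.
Qed.

Lemma component_in s (z : component_vertex) :
  exists! y : component_vertex, edge s (sval y) (sval z).
Proof.
have [y [yz yP]] := edge_in s (sval z).
have cy : conn u0 y by apply: conn_adj (svalP z) _; exists s; right.
by exists (exist _ y cy); split=> // y' /yP yy'; exact: component_vertex_inj.
Qed.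

Definition component_graph : marked_graph := MarkedGraph component_out component_in.

Lemma trace_component w (y z : component_graph) :
  trace w y z <-> trace w (sval y) (sval z).
Proof.
elim: w y => [|a w IH] y /=; first by split=> [->//|]; exact: component_vertex_inj.
have edgeE (c c' : component_graph) : letter_edge a c c' <-> letter_edge a (sval c) (sval c').
  by case: a => s [].
split=> [[c yc cz]|[c yc cz]].
  by exists (sval c); [apply/edgeE|apply/IH].
have cc : conn u0 c by apply: conn_adj (svalP y) _; apply/adj_letter; exists a.
by exists (exist _ c cc); [apply/edgeE|apply/IH].
Qed.

Definition component_base : component_graph :=
  exist (fun v => conn u0 v) u0 (ex_intro _ 0%N erefl).

Lemma component_connected (v : component_graph) : exists k, walk k component_base v.
Proof.
have [k /walk_trace[w wk uv]] := svalP v.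
by exists k; apply/walk_trace; exists w => //; apply/trace_component.
Qed.

Definition component : pmgraph := PMGraph component_connected.

Lemma loop_component w : loop component w <-> trace w u0 u0.
Proof. exact: trace_component. Qed.

End component.

Lemma prepend_common_extension p p' u u' : prepend p u = prepend p' u' ->
  exists r r' z, [/\ p ++ r = p' ++ r', u = prepend r z & u' = prepend r' z].
Proof.
have nil (z : cantor_space) : z = prepend [::] z.
  by apply: funext => n; rewrite /prepend subn0.
move=> e; have [pp|/ltnW pp] := leqP (size p) (size p').
  have [r -> ur] := prepend_split pp e.
  by exists r, [::], u'; rewrite cats0 -nil.
have [r -> ur] := prepend_split pp (esym e).
by exists [::], r, u; rewrite cats0 -nil.
Qed.

(** The points of the Cantor set appear as plain functions here, so that this
    type lies in the lowest universe and can serve as a set of vertices. *)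
Definition germ : Set := ((nat -> bool) * int)%type.

Section germs.
Variable R : realType.
Implicit Types (f g : R -> R) (x y z : germ) (u v : cantor_space).

(** Near a given point of the Cantor set, an element of F is determined by the
    image u of this point and by its slope 2 ^ (- k) there; the pair (u, k) stands
    for this germ. The relation is the composition of germs with that of f at the
    first component of x, whose slope is 2 ^ (size p - size q). *)
Definition germ_map f x y : Prop := exists p q v,
  [/\ maps_cylinder f p q, x.1 = prepend p v &
      y = (prepend q v, x.2 + (size q)%:Z - (size p)%:Z)].

Lemma germ_map_fun f x y y' : germ_map f x y -> germ_map f x y' -> y = y'.
Proof.
case=> p [q [v [fpq xp ->]]] [p' [q' [v' [fpq' xp' ->]]]].
have [r [r' [z [e vE v'E]]]] := prepend_common_extension (etrans (esym xp) xp').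
have qq : q ++ r = q' ++ r'.
  apply: maps_cylinder_fun (maps_cylinder_cat r fpq) _.
  by rewrite e; exact: maps_cylinder_cat.
rewrite vE v'E -!prepend_cat qq; congr pair.
have := congr1 size e; have := congr1 size qq; rewrite !size_cat; lia.
Qed.

Lemma germ_map_total f x : is_thompson f -> exists y, germ_map f x y.
Proof.
move=> tf; have [n [q fq]] := thompson_maps_cylinder x.1 tf.
eexists; exists (cyl_take x.1 n), q, (cyl_drop x.1 n).
by split; first exact: fq; first exact: prepend_take_drop.
Qed.

Lemma germ_map_comp f g x y z :
  germ_map f x y -> germ_map g y z -> germ_map (g \o f) x z.
Proof.
case=> p [q [v [fpq xp ->]]] [p' [q' [v' [gpq /= yp ->]]]].
have [r [r' [t [e vE v'E]]]] := prepend_common_extension yp.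
exists (p ++ r), (q' ++ r'), t; split.
- apply: maps_cylinder_comp (maps_cylinder_cat r fpq) _.
  by rewrite e; exact: maps_cylinder_cat.
- by rewrite prepend_cat -vE.
- rewrite prepend_cat -v'E; congr pair.
  by have := congr1 size e; rewrite !size_cat; lia.
Qed.

Lemma germ_map_inv f x y : is_thompson f -> germ_map (tinv f) x y <-> germ_map f y x.
Proof.
move=> tf; split=> [] [p [q [v [fpq xp e]]]]; exists q, p, v.
  rewrite e /= -xp; split=> //.
    move=> t t01; rewrite -fpq //.
    by have [] := tinvP tf (word_val_itv p t01).
  by rewrite [LHS]surjective_pairing; congr pair; lia.
rewrite e /= -xp; split=> //; first exact: maps_cylinder_tinv.
by rewrite [LHS]surjective_pairing; congr pair; lia.
Qed.

Lemma germ_out s x : exists! y, germ_map (gen_map R s) x y.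
Proof.
have [y xy] := germ_map_total x (thompsonP (gen_map R s)).
by exists y; split=> // y'; exact: germ_map_fun.
Qed.

Lemma germ_in s y : exists! x, germ_map (gen_map R s) x y.
Proof.
have [x /germ_map_inv yx] := germ_map_total y (is_thompson_inv (thompsonP (gen_map R s))).
exists x; split; first exact/yx/thompsonP.
move=> x' /germ_map_inv x'y; apply: germ_map_fun (x'y _); last exact: thompsonP.
by apply/germ_map_inv; [exact: thompsonP|exact/yx/thompsonP].
Qed.

Definition germ_graph : marked_graph := MarkedGraph germ_out germ_in.

Lemma trace_germ w (x y : germ_graph) : trace w x y <-> germ_map (word_map R w) x y.
Proof.
have idE x' : germ_map id x' x'.
  exists [::], [::], x'.1; split=> //.
    by apply: funext => n; rewrite /prepend subn0.
  rewrite [LHS]surjective_pairing; congr pair; last by rewrite addrK.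
  by apply: funext => n; rewrite /prepend subn0.
have edgeE l (c c' : germ_graph) :
    letter_edge l c c' <-> germ_map (letter_map R l) c c'.
  case: l => s [] //=; rewrite /letter_edge /letter_map /=.
  by symmetry; apply: germ_map_inv; exact: thompsonP.
elim: w x => [|l w IH] x /=.
  by split=> [->|]; [exact: idE|exact: germ_map_fun (idE x)].
split=> [[c /edgeE xc /IH cy]|xy]; first exact: germ_map_comp xc cy.
have [c xc] := germ_map_total x (thompsonP (letter_map R l)).
have [y' cy'] := germ_map_total c (thompsonP (word_map R w)).
exists c; first exact/edgeE.
by apply/IH; rewrite (germ_map_fun xy (germ_map_comp xc cy')).
Qed.

Lemma germ_map_loop f u k : germ_map f (u, k) (u, k) <->
  exists n, maps_cylinder f (cyl_take u n) (cyl_take u n).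
Proof.
split=> [[p [q [v [fpq /= up [uq]]]]]|[n fn]]; last first.
  exists (cyl_take u n), (cyl_take u n), (cyl_drop u n); split=> //.
    exact: prepend_take_drop.
  by rewrite addrK -prepend_take_drop.
move=> kk; have pq : size p = size q by lia.
have pu : cyl_take u (size p) = p by rewrite up cyl_take_prepend.
have qu : cyl_take u (size p) = q by rewrite pq uq cyl_take_prepend.
by exists (size p); rewrite {1}pu qu.
Qed.

(** The pointed graph of the germs at u of the elements of F. Its closed words
    are those that act as the identity near u. *)
Definition germ_pt u : mgspace R :=
  mgclass R (component ((u, 0) : germ_graph)).

Lemma loops_germ u w : loops (germ_pt u) w <->
  exists n, maps_cylinder (word_map R w) (cyl_take u n) (cyl_take u n).
Proof. by rewrite loops_mgclass loop_component trace_germ germ_map_loop. Qed.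

End germs.

(** * Schreier graphs near a point of the Cantor set *)

Section limits.
Variable R : realType.
Implicit Types (u v : cantor_space) (p : seq bool) (w : word) (q : half_vertex R).
Implicit Types x y : mgspace R.

Lemma cyl_take_eq_le u v m n : (m <= n)%N ->
  cyl_take v n = cyl_take u n -> cyl_take v m = cyl_take u m.
Proof. by move=> mn vu; rewrite -(take_cyl_take v mn) vu take_cyl_take. Qed.

Lemma inside_cyl_take_le u m n (t : R) : (m <= n)%N ->
  inside (cyl_take u n) t -> inside (cyl_take u m) t.
Proof. by move=> mn /(inside_take m); rewrite take_cyl_take. Qed.

Lemma inside_cyl_take_uniq u p (t : R) : inside (cyl_take u (size p)) t ->
  inside p t <-> cyl_take u (size p) = p.
Proof.
move=> ut; split=> [pt|<- //].
by apply: inside_level_inj ut pt; rewrite size_mkseq.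
Qed.

Lemma half_vertex_level q : exists n (m : nat), sval q = m%:R / 2 ^+ n.
Proof.
have q01 := half_orbit01 q; have [m [n qE]] := half_orbit_dyadic q.
exists n, (absz m); rewrite qE -{1}(@gez0_abs m) //.
have : 0 < sval q by case/andP: q01.
by rewrite qE pmulr_lgt0 ?exp2_gt0 // ltr0z => /ltW.
Qed.

(** An affine map with two fixed points is the identity. *)
Lemma maps_cylinder_fixed2 (f : R -> R) p p' s t : maps_cylinder f p p' ->
  inside p s -> inside p t -> f s = s -> f t = t -> s <> t -> p = p'.
Proof.
move=> fpp' /insideE[a a01 sE] /insideE[b b01 tE].
have a1 : 0 <= a <= 1 by lra.
have b1 : 0 <= b <= 1 by lra.
rewrite sE tE (fpp' a a1) (fpp' b b1); set P := word_val R p; set P' := word_val R p'.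
move=> ha hb.
have e0 r : (2 : R) ^+ size r != 0 by rewrite expf_neq0.
have e : (a - b) * (2 ^- size p' - 2 ^- size p) = 0 by lra.
move=> st; move/eqP: e; rewrite mulf_eq0 !subr_eq0 => /orP[/eqP ab|/eqP e].
  by case: st; rewrite ab.
have pp' : size p = size p'.
  by move/invr_inj/esym: e; apply: ieexprIn; lra.
by apply: (@word_val_inj R) => //; rewrite -/P -/P'; move: ha; rewrite pp'; lra.
Qed.

Lemma loops_germ_cylinder w u n p : maps_cylinder (word_map R w) (cyl_take u n) p ->
  loops (germ_pt R u) w <-> p = cyl_take u n.
Proof.
move=> wp; rewrite loops_germ; split=> [/(@germ_map_loop R _ u 0) uu|pE]; last first.
  by exists n; move: wp; rewrite pE.
have up : germ_map (word_map R w) (u, 0)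
    (prepend p (cyl_drop u n), 0 + (size p)%:Z - (size (cyl_take u n))%:Z).
  by exists (cyl_take u n), p, (cyl_drop u n); split=> //; exact: prepend_take_drop.
have [uE kE] := germ_map_fun uu up.
have pn : size p = n by move: kE; rewrite size_mkseq; lia.
by rewrite uE -pn cyl_take_prepend.
Qed.

(** On the interval of a prefix of u where the map of w is affine, it is the
    identity or has at most one fixed point. If this fixed point is dyadic, it is
    an end of an interval of some level and lies outside all open intervals of
    higher levels. *)
Lemma loops_near_germ w u : exists m, forall q, inside (cyl_take u m) (sval q) ->
  loops (schreier_pt q) w <-> loops (germ_pt R u) w.
Proof.
have [n [p wp]] := thompson_maps_cylinder u (thompsonP (word_map R w)).
have uw := loops_germ_cylinder wp.
have [pE|pE] := pselect (p = cyl_take u n).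
  exists n => q /insideE[t t01 qE]; rewrite loops_schreier uw; split=> // _.
  by rewrite qE wp ?pE //; lra.
have [[q0 [q0n q0w]]|noq] := pselect (exists q0, inside (cyl_take u n) (sval q0) /\
    word_map R w (sval q0) = sval q0); last first.
  exists n => q qn; rewrite loops_schreier uw; split=> // qw.
  by case: noq; exists q.
have [e [i q0E]] := half_vertex_level q0.
exists (maxn n e) => q qu; rewrite loops_schreier uw; split=> // qw; exfalso.
have qn : inside (cyl_take u n) (sval q) by exact: inside_cyl_take_le (leq_maxl n e) qu.
apply: pE; symmetry; apply: (maps_cylinder_fixed2 wp qn q0n) => // qq0.
apply: level_not_inside (qu); last by rewrite qq0; exact: q0E.
by rewrite size_mkseq leq_maxr.
Qed.

(** A threshold that depends on a word can be chosen uniformly for the finitely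
    many words of bounded length. *)
Lemma bounded_words (Q : word -> nat -> Prop) :
  (forall w i j, (i <= j)%N -> Q w i -> Q w j) -> (forall w, exists m, Q w m) ->
  forall n, exists m, forall w, (size w <= n)%N -> Q w m.
Proof.
move=> Qle Qex n; elim: n Q Qle Qex => [|n IH] Q Qle Qex.
  by have [m Qm] := Qex [::]; exists m => w; rewrite leqn0 => /nilP->.
have [m0 Q0] := Qex [::].
have /choice[M MP] : forall a, exists m, forall w, (size w <= n)%N -> Q (a :: w) m.
  move=> a; apply: (IH (fun w => Q (a :: w))) => // w i j; exact: Qle.
pose m1 := maxn (M (X0, true)) (M (X0, false)); pose m2 := maxn (M (X1, true)) (M (X1, false)).
have MM a : (M a <= maxn m1 m2)%N.
  by case: a => -[] []; rewrite !leq_max leqnn ?orbT.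
exists (maxn m0 (maxn m1 m2)) => -[_|a w wn]; first exact: Qle (leq_maxl _ _) Q0.
by apply: Qle (MP a w wn); apply: leq_trans (MM a) (leq_maxr _ _).
Qed.

Lemma agree_germ_schreier n u : exists m, forall q,
  inside (cyl_take u m) (sval q) -> agree n (germ_pt R u) (schreier_pt q).
Proof.
have [w i j ij wi q /(inside_cyl_take_le ij)/wi//|w|m mP] := @bounded_words
  (fun w m => forall q, inside (cyl_take u m) (sval q) ->
    loops (germ_pt R u) w <-> loops (schreier_pt q) w) _ _ n.
  by have [m mP] := loops_near_germ w u; exists m => q /mP->.
by exists m => q qm w /mP; apply.
Qed.

Lemma agree_germ_germ n u : exists m, forall v,
  cyl_take v m = cyl_take u m -> agree n (germ_pt R u) (germ_pt R v).
Proof.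
have [w i j ij wi v /(cyl_take_eq_le ij)/wi//|w|m mP] := @bounded_words
  (fun w m => forall v, cyl_take v m = cyl_take u m ->
    loops (germ_pt R u) w <-> loops (germ_pt R v) w) _ _ n.
  have [m [p wp]] := thompson_maps_cylinder u (thompsonP (word_map R w)).
  exists m => v vu; rewrite (loops_germ_cylinder wp) -vu.
  by rewrite (@loops_germ_cylinder w v m p) // vu.
by exists m => v vu w /mP; apply.
Qed.

(** By these words a position can be read off from a pointed graph: the word is
    closed unless the base vertex is in the interval of p. *)
Definition support_word p : word := sval (cid (moves_exactly_inside R p)).

Lemma loops_support_schreier p q :
  loops (schreier_pt q) (support_word p) <-> ~ inside p (sval q).
Proof.
rewrite loops_schreier; apply: (svalP (cid (moves_exactly_inside R p))).
by have := half_orbit01 q; lra.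
Qed.

(** Compare with a Schreier graph based at a vertex that is close to u. *)
Lemma loops_support_germ p u :
  loops (germ_pt R u) (support_word p) <-> cyl_take u (size p) <> p.
Proof.
have [m mP] := loops_near_germ (support_word p) u.
have [q qu] := half_orbit_inside R (cyl_take u (maxn m (size p))).
rewrite -(mP q) ?loops_support_schreier; last exact: inside_cyl_take_le (leq_maxl _ _) qu.
rewrite (inside_cyl_take_uniq (u := u)) //.
exact: inside_cyl_take_le (leq_maxr _ _) qu.
Qed.

Lemma germ_pt_support u n : ~ loops (germ_pt R u) (support_word (cyl_take u n)).
Proof. by move/loops_support_germ; rewrite size_mkseq. Qed.

(** If u and v differ in their first n digits, the word for the interval of the
    first n digits of u is closed for v but not for u. *)
Lemma germ_pt_inj : injective (@germ_pt R).
Proof.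
move=> u v uv; apply: cantor_eq => n; apply/esym/not_notP => vu.
apply: (@germ_pt_support u n); rewrite uv; apply/loops_support_germ.
by rewrite size_mkseq.
Qed.

Lemma nbhs_loops x w : nbhs x [set y | loops y w <-> loops x w].
Proof. by apply/nbhs_agreeP; exists (size w) => y /(_ w (leqnn _)) []; split. Qed.

Lemma cvg_germ_ptP (q : nat -> half_vertex R) u :
  schreier_pt (q n) @[n --> \oo] --> germ_pt R u <->
  forall m, \forall n \near \oo, inside (cyl_take u m) (sval (q n)).
Proof.
split=> [qu m|qu A /nbhs_agreeP[n nA]].
  have h : \forall n \near \oo, loops (schreier_pt (q n)) (support_word (cyl_take u m))
      <-> loops (germ_pt R u) (support_word (cyl_take u m)).
    exact: (qu _ (nbhs_loops _ _)).
  apply: filterS h => n [h _]; apply: contra_notP (@germ_pt_support u m) => nq.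
  by apply/h/loops_support_schreier.
have [m mP] := agree_germ_schreier n u.
by apply: filterS (qu m) => i /mP/nA.
Qed.

Lemma schreier_approx u : exists q : nat -> half_vertex R,
  schreier_pt (q n) @[n --> \oo] --> germ_pt R u.
Proof.
have /choice[q qP] : forall n, exists q, inside (cyl_take u n) (sval q).
  by move=> n; exact: half_orbit_inside.
exists q; apply/cvg_germ_ptP => m; near=> n.
apply: inside_cyl_take_le (qP n); near: n; exact: nbhs_infty_ge.
Unshelve. all: by end_near. Qed.

(** * The closure of the set of pointed Schreier graphs *)

Definition level_set n : set (mgspace R) :=
  [set schreier_pt q | q in [set q | exists m : nat, sval q = m%:R / 2 ^+ n]].

Lemma finite_level_set n : finite_set (level_set n).
Proof.
have /choice[g gP] : forall m : nat, exists q, (exists q', sval q' = m%:R / 2 ^+ n :> R) ->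
    sval q = m%:R / 2 ^+ n.
  move=> m; have [[q qm]|nq] := pselect (exists q', sval q' = m%:R / 2 ^+ n :> R).
    by exists q.
  by exists (Defs.half R).
apply: (@sub_finite_set _ _ [set schreier_pt (g m) | m in `I_(2 ^ n)]); last first.
  exact/finite_image/finite_II.
move=> _ [q [m qm] <-]; exists m.
  have : sval q < 1 by have /andP[] := half_orbit01 q.
  by rewrite /= qm ltr_pdivrMr ?exprn_gt0 // mul1r -natrX ltr_nat.
congr schreier_pt; apply: half_vertex_inj; rewrite gP ?qm //.
by exists q.
Qed.

Lemma mgspace_finite_closed (A : set (mgspace R)) : finite_set A -> closed A.
Proof.
move: A; apply/accessible_finite_set_closed/hausdorff_accessible.
exact: metric_hausdorff.
Qed.

(** The base vertex avoids all open intervals of level n. This depends on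
    finitely many words, so that it is an open condition, and the only pointed
    Schreier graphs that satisfy it are those based at multiples of 1 / 2 ^ n. *)
Definition fixes_level n : set (mgspace R) :=
  [set x | forall p, size p = n -> loops x (support_word p)].

Lemma nbhs_fixes_level n x : fixes_level n x -> nbhs x (fixes_level n).
Proof.
move=> xn; apply/nbhs_agreeP.
exists (\max_(p : n.-tuple bool) size (support_word p)) => y xy p pn.
apply/(xy _ _); last exact: xn.
have pn' : size p == n by apply/eqP.
exact: (@leq_bigmax _ (fun p : n.-tuple bool => size (support_word p)) (Tuple pn')).
Qed.

(** The finite set [level_set n] is closed, so a limit of its elements belongs
    to it. *)
Lemma closure_fixes_level n x :
  closure (schreier_set R) x -> fixes_level n x -> level_set n x.
Proof.
move=> Cx xn; apply: contrapT => nx.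
have nxn : nbhs x (~` level_set n).
  apply: open_nbhs_nbhs; split=> //; apply: closed_openC; apply: mgspace_finite_closed.
  exact: finite_level_set.
have [_ [[q _ <-] [qn]]] := Cx _ (filterI (nbhs_fixes_level xn) nxn); apply.
exists q => //; have [|[p pn pq]|//] := @inside_or_level R n (sval q).
  exact: half_orbit01.
by have := qn p pn; move=> /loops_support_schreier.
Qed.

Lemma schreier_fixes_level q : exists n, fixes_level n (schreier_pt q).
Proof.
have [n [m qm]] := half_vertex_level q; exists n => p pn.
apply/loops_support_schreier; apply: level_not_inside qm.
by rewrite pn.
Qed.

(** For each n the graph x tells an interval of level n in which the base vertices
    of all pointed Schreier graphs close to x lie. These intervals are nested, and
    so they describe a point u of the Cantor set. *)
Lemma closure_germ x : closure (schreier_set R) x ->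
  (forall n, ~ fixes_level n x) -> exists u, x = germ_pt R u.
Proof.
move=> Cx nfix.
have /choice[P PP] : forall n, exists p, size p = n /\ ~ loops x (support_word p).
  move=> n; have /existsNP[p /not_implyP[pn xp]] := nfix n.
  by exists p.
have near k : exists q, agree k x (schreier_pt q).
  have /Cx[_ [[q _ <-] xq]] : nbhs x (agree k x) by apply/nbhs_agreeP; exists k.
  by exists q.
have inP n q : agree (size (support_word (P n))) x (schreier_pt q) -> inside (P n) (sval q).
  move=> /(_ _ (leqnn _)) xq; apply: contrapT => /loops_support_schreier/xq.
  exact: (PP n).2.
have nested m n : (m <= n)%N -> take m (P n) = P m.
  move=> mn; have [q xq] := near (maxn (size (support_word (P m))) (size (support_word (P n)))).
  have := @inside_prefix R (P m) (P n) (sval q); rewrite !(PP _).1; apply=> //.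
    exact/inP/(agree_le (leq_maxl _ _) xq).
  exact/inP/(agree_le (leq_maxr _ _) xq).
pose u : cantor_space := fun n => nth false (P n.+1) n.
have uP n : cyl_take u n = P n.
  apply: (@eq_from_nth _ false); rewrite size_mkseq ?(PP n).1 // => i in_.
  by rewrite nth_mkseq // /u -(nested i.+1 n) // nth_take.
exists u; apply: loops_inj => w; have [m mP] := loops_near_germ w u.
have [q xq] := near (maxn (size w) (size (support_word (P m)))).
rewrite -(mP q); first by apply: xq; rewrite leq_maxl.
by rewrite uP; exact/inP/(agree_le (leq_maxr _ _) xq).
Qed.

Lemma germ_in_closure u : closure (schreier_set R) (germ_pt R u).
Proof.
move=> A /nbhs_agreeP[n nA]; have [m mP] := agree_germ_schreier n u.
have [q /mP/nA qA] := half_orbit_inside R (cyl_take u m).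
by exists (schreier_pt q); split=> //; exists q.
Qed.

Lemma schreier_isolated q : isolated (closure (schreier_set R)) (schreier_pt q).
Proof.
have Cq : closure (schreier_set R) (schreier_pt q) by apply: subset_closure; exists q.
have [n qn] := schreier_fixes_level q.
split; first by rewrite inE.
exists (fixes_level n `&` ~` (level_set n `\ schreier_pt q)).
  apply: filterI; first exact: nbhs_fixes_level.
  apply: open_nbhs_nbhs; split; last by move=> [_]; apply.
  apply: closed_openC; apply: mgspace_finite_closed; apply: finite_setD.
  exact: finite_level_set.
apply/seteqP; split=> [y [[yn ny] Cy]|_ ->].
  by apply: contrapT => yq; apply: ny; split=> //; exact: closure_fixes_level.
by split=> //; split=> // -[_]; apply.
Qed.

(** Changing a digit of u far out gives another graph close to [germ_pt u]. *)
Lemma germ_not_isolated (B : set (mgspace R)) u :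
  range (@germ_pt R) `<=` B -> ~ isolated B (germ_pt R u).
Proof.
move=> gB [_ [V /nbhs_agreeP[n nV] VB]]; have [m mP] := agree_germ_germ n u.
pose v : cantor_space := fun i => if i == m then ~~ u i else u i.
have vu : cyl_take v m = cyl_take u m.
  apply/eq_in_map => i; rewrite mem_iota add0n => /andP[_ im].
  by rewrite /v ltn_eqF.
have /germ_pt_inj uv : germ_pt R v = germ_pt R u.
  have : (V `&` B) (germ_pt R v) by split; [exact: (nV _ (mP v vu))|apply: gB; exists v].
  by rewrite VB.
by have := congr1 (@^~ m) uv; rewrite /v eqxx; case: (u m).
Qed.

(** Removing the isolated points once leaves the image of [germ_pt]; and this
    image survives all steps because it has no isolated points. *)
Lemma perfect_kernel_closure :
  perfect_kernel (closure (schreier_set R)) = range (@germ_pt R).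
Proof.
apply/seteqP; split=> [x xD|_ [u _ <-] B].
  have [Cx nx] := xD _ (cb_step (cb_start _)).
  have [|u ->] := closure_germ Cx; last by exists u.
  move=> n xn; apply: nx.
  by have [q _ <-] := closure_fixes_level Cx xn; exact: schreier_isolated.
suff : cb_iterate (closure (schreier_set R)) B -> range (@germ_pt R) `<=` B.
  by move=> h /h; apply; exists u.
elim=> {B} [|B _ gB|S _ _ gS] _ [v _ <-]; first exact: germ_in_closure.
  by split; [apply: gB; exists v|exact: germ_not_isolated].
by move=> B SB; apply: gS => //; exists v.
Qed.

(** * The conjugacy *)

(** The images under f of the vertices approaching u approach the image of u, as
    f maps the intervals of the long prefixes of u to those of the prefixes
    of its image. *)
Lemma schreier_act_germ (f : thompson R) u :
  schreier_act f (germ_pt R u) = germ_pt R (cantor_act f u).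
Proof.
have [n [p fp]] := thompson_maps_cylinder u (thompsonP f).
have fu : cantor_act f u = prepend p (cyl_drop u n).
  by rewrite [in LHS](prepend_take_drop u n) (cantor_actE _ fp).
have cvg_act (q : nat -> half_vertex R) : schreier_pt (q n) @[n --> \oo] --> germ_pt R u ->
    schreier_pt (orbit_act f (q n)) @[n --> \oo] --> germ_pt R (cantor_act f u).
  move=> /cvg_germ_ptP qu; apply/cvg_germ_ptP => m.
  apply: filterS (qu (n + m)%N) => i qi.
  apply: (@inside_cyl_take_le _ m (size p + m)); first exact: leq_addl.
  rewrite fu cyl_take_prepend_cat.
  apply: maps_cylinder_inside_hom (maps_cylinder_cat _ fp) _.
  by rewrite -cyl_takeD.
apply: get_unique => // y yP; have [q qu] := schreier_approx u.
by apply: (cvg_unique _ (yP q qu) (cvg_act q qu)); exact: metric_hausdorff.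
Qed.

Lemma nbhs_cantorP u (A : set cantor_space) :
  nbhs u A <-> exists m, forall v, cyl_take v m = cyl_take u m -> A v.
Proof.
pose cyl_ m : set cantor_space := [set v | cyl_take v m = cyl_take u m].
split=> [|[m mA]]; last first.
  have coord i : nbhs u [set v : cantor_space | v i = u i].
    by apply: (@proj_continuous nat (fun=> bool) i u [set u i]); exact: discrete_set1.
  suff : nbhs u (cyl_ m) by apply: filterS; exact: mA.
  elim: m {mA} => [|m IH]; first by apply: filterS filterT => v _.
  apply: filterS (filterI IH (coord m)) => v [vu um].
  by rewrite /cyl_ /= /cyl_take !mkseqS -/(cyl_take v m) vu um.
pose F : set_system cantor_space := filter_from setT cyl_.
have FF : Filter F.
  apply: filter_from_filter; first by exists 0%N.
  move=> i j _ _; exists (maxn i j) => // v vu; split.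
    exact: cyl_take_eq_le (leq_maxl i j) vu.
  exact: cyl_take_eq_le (leq_maxr i j) vu.
suff Fu : F --> u by move=> /Fu[m _ mA]; exists m => v /mA.
apply/cvg_sup => i U.
have /= -> := @nbhsE (initial_topology (fun f : nat -> bool => f i)) u.
case=> B [[C oC <-] Cu] /filterS; apply; exists i.+1 => // v vu /=.
have -> // : v i = u i.
have := congr1 (nth false ^~ i) vu; by rewrite !nth_mkseq.
Qed.

Lemma germ_pt_continuous : continuous (@germ_pt R).
Proof.
move=> u A /nbhs_agreeP[n nA]; have [m mP] := agree_germ_germ n u.
by apply/nbhs_cantorP; exists m => v /mP/nA.
Qed.

Definition germ_point x : cantor_space := get [set u | germ_pt R u = x].

Lemma germ_pt_K : cancel (@germ_pt R) germ_point.
Proof. by move=> u; apply: get_unique => // v /germ_pt_inj. Qed.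

Lemma germ_point_homeomorphism : homeomorphism_from (range (@germ_pt R)) germ_point.
Proof.
split; [|split].
- split=> //.
  + by move=> _ _ /set_mem[u _ <-] /set_mem[v _ <-]; rewrite !germ_pt_K => ->.
  + by move=> u _; exists (germ_pt R u); [exists u|exact: germ_pt_K].
- apply/subspace_continuousP => _ [u _ <-] A Au.
  have /nbhs_cantorP[m mA] : nbhs u A by rewrite -{1}(germ_pt_K u).
  have := nbhs_loops (germ_pt R u) (support_word (cyl_take u m)).
  apply: filterS => x h [v _ xv]; move: h.
  rewrite -xv /= /from_subspace germ_pt_K => h; apply: mA.
  apply: contrapT => vu; apply: (@germ_pt_support u m); apply/h.
  by apply/loops_support_germ; rewrite size_mkseq.
- exists (@germ_pt R); first exact: germ_pt_continuous.
  by move=> _ [u _ <-]; rewrite germ_pt_K.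
Qed.

End limits.

Theorem theorem4p3 (R : realType) :
  let D : set (mgspace R) := perfect_kernel (closure (schreier_set R)) in
  (forall (f : thompson R) (x : mgspace R), D x -> D (schreier_act f x)) /\
  exists psi : mgspace R -> cantor_space,
    homeomorphism_from D psi /\
    forall (f : thompson R) (x : mgspace R), D x ->
      psi (schreier_act f x) = cantor_act f (psi x).
Proof.
move=> D; rewrite /D perfect_kernel_closure; split.
  by move=> f _ [u _ <-]; rewrite schreier_act_germ; exists (cantor_act f u).
exists (@germ_point R); split; first exact: germ_point_homeomorphism.
by move=> f _ [u _ <-]; rewrite schreier_act_germ !germ_pt_K.
Qed.
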